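(* Let $K$ be an abstract elementary class, let $\lambda\ge\mathrm{LS}(K)$, and let $\mathfrak{s}_1,\mathfrak{s}_2$ be weakly successful good $\lambda$-frames with underlying AEC $K$ and the same basic types. Then $\mathfrak{s}_1=\mathfrak{s}_2$ (that is, their nonforking relations coincide).
   Context: No monster model is assumed. $K_\lambda$ is the class of models of $K$ of size $\lambda$. For $M\prec N$ in $K_\lambda$ and $a\in N$, $\mathrm{gtp}(a/M;N)$ is the Galois type: $\mathrm{gtp}(a_1/M;N_1)=\mathrm{gtp}(a_2/M;N_2)$ iff there are $N\in K_\lambda$ and $K$-embeddings $f_\ell:N_\ell\to N$ fixing $M$ pointwise with $f_1(a_1)=f_2(a_2)$ (an equivalence relation under amalgamation in $K_\lambda$). $S(M)$ is the set of Galois types of single elements over $M$; a type is nonalgebraic if it is not realized in $M$. A superlimit model in $K_\lambda$ is $M\in K_\lambda$ such that every model of $K_\lambda$ embeds into $M$; for every $N\in K_\lambda$ with $M\prec N$ there is $M'\in K_\lambda$ with $N\prec M'$, $N\neq M'$, and $M'\cong M$; and the union of any increasing chain of length a limit ordinal $\delta<\lambda^+$ of models isomorphic to $M$ is isomorphic to $M$. A good $\lambda$-frame (Shelah) is $\mathfrak{s}=(K,S^{\mathrm{bs}},\downarrow)$ such that: (A) $K$ is an AEC with $\mathrm{LS}(K)\le\lambda$ and $K_\lambda\ne\emptyset$. (B) $K_\lambda$ has a superlimit model. (C) $K_\lambda$ has amalgamation, joint embedding and no $\prec$-maximal model. (D) For $M\in K_\lambda$, $S^{\mathrm{bs}}(M)\subseteq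 S(M)$ is a set of nonalgebraic types (the basic types), invariant under isomorphism. Density: if $M\prec N$ are in $K_\lambda$ and $M\ne N$, there is $a\in N\setminus M$ with $\mathrm{gtp}(a/M;N)\in S^{\mathrm{bs}}(M)$. Stability: $|S^{\mathrm{bs}}(M)|\le\lambda$ for all $M\in K_\lambda$. (E) $\downarrow$ is a relation, invariant under isomorphism, on quadruples $(M_0,a,M_1,M_3)$ with $M_0\prec M_1\prec M_3$ in $K_\lambda$, $a\in M_3\setminus M_1$, written $a\downarrow_{M_0}^{M_3}M_1$; whenever it holds, $\mathrm{gtp}(a/M_0;M_3)$ and $\mathrm{gtp}(a/M_1;M_3)$ are basic. All models below are in $K_\lambda$. - Monotonicity: if $a\downarrow_{M_0}^{M_3}M_1$, $M_0\prec M_0'\prec M_1'\prec M_1\prec M_3\prec M_3'$, then $a\downarrow_{M_0'}^{M_3'}M_1'$; and moreover if $M_1'\cup\{a\}\subseteq M_3''\prec M_3'$ then $a\downarrow_{M_0'}^{M_3''}M_1'$. Hence it makes sense to say that $p\in S^{\mathrm{bs}}(M_1)$ does not fork over $M_0$, meaning $a\downarrow_{M_0}^{M_3}M_1$ for some (equivalently any) $(a,M_3)$ with $p=\mathrm{gtp}(a/M_1;M_3)$. - Local character: if $\delta<\lambda^+$ is a limit ordinal, $(M_i)_{i\le\delta}$ is increasing continuous and $p\in S^{\mathrm{bs}}(M_\delta)$, then $p$ does not fork over $M_i$ for some $i<\delta$. - Transitivity: if $M_0\prec M_1\prec M_2$, $p\in S^{\mathrm{bs}}(M_2)$ does not fork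 over $M_1$ and $p\upharpoonright M_1$ does not fork over $M_0$, then $p$ does not fork over $M_0$. - Uniqueness: if $M_0\prec M_1$ and $p,q\in S^{\mathrm{bs}}(M_1)$ do not fork over $M_0$ and $p\upharpoonright M_0=q\upharpoonright M_0$, then $p=q$. - Symmetry: if $M_0\prec M_1\prec M_3$, $a_1\in M_1$, $\mathrm{gtp}(a_1/M_0;M_3)\in S^{\mathrm{bs}}(M_0)$ and $a_2\downarrow_{M_0}^{M_3}M_1$, then there are $M_2,M_3'$ with $M_0\prec M_2\prec M_3'$, $M_3\prec M_3'$, $a_2\in M_2$ and $a_1\downarrow_{M_0}^{M_3'}M_2$. - Extension: if $M\prec N$ and $p\in S^{\mathrm{bs}}(M)$, there is $q\in S^{\mathrm{bs}}(N)$ extending $p$ which does not fork over $M$. - Continuity: if $\delta<\lambda^+$ is a limit ordinal, $(M_i)_{i\le\delta}$ is increasing continuous, $p\in S(M_\delta)$, and for all $i<\delta$ $p\upharpoonright M_i\in S^{\mathrm{bs}}(M_i)$ does not fork over $M_0$, then $p\in S^{\mathrm{bs}}(M_\delta)$ and $p$ does not fork over $M_0$. Weakly successful. A triple $(a,M,N)$ with $M\prec N$ in $K_\lambda$, $a\in N$ and $\mathrm{gtp}(a/M;N)\in S^{\mathrm{bs}}(M)$ is a uniqueness triple of $\mathfrak{s}$ if for every $M_1\in K_\lambda$ with $M\prec M_1$ and any two amalgams $(f_\ell,g_\ell,N_\ell)$ ($\ell=1,2$), where $N_\ell\in K_\lambda$ and $f_\ell:M_1\to N_\ell$, $g_\ell:N\to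 N_\ell$ are $K$-embeddings fixing $M$ pointwise with $\mathrm{gtp}(g_\ell(a)/f_\ell[M_1];N_\ell)$ not forking over $M$, there are $N_*\in K_\lambda$ and $K$-embeddings $h_\ell:N_\ell\to N_*$ with $h_1\circ f_1=h_2\circ f_2$ and $h_1\circ g_1=h_2\circ g_2$. The frame $\mathfrak{s}$ is weakly successful if for every $M\in K_\lambda$ and $p\in S^{\mathrm{bs}}(M)$ there are $N,a$ such that $p=\mathrm{gtp}(a/M;N)$ and $(a,M,N)$ is a uniqueness triple of $\mathfrak{s}$. ''The same basic types'' means $S^{\mathrm{bs}}_{\mathfrak{s}_1}(M)=S^{\mathrm{bs}}_{\mathfrak{s}_2}(M)$ for all $M\in K_\lambda$. *)

(* Defs.v *)
From mathcomp Require Import all_boot wochoice all_classical.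

Set Implicit Arguments.
Unset Strict Implicit.
Unset Printing Implicit Defensive.

Local Open Scope classical_set_scope.
Local Open Scope card_scope.

(* Small types play the role of sets.  The cardinal represented by a small type
   A is its number of elements, and the comparison of cardinals is #<= and #=
   between full sets [set: A].  An ordinal is represented by a small type with
   a (reflexive) well-order. *)
Definition SmallType := Type.

(* The class of all possible elements of structures: the disjoint union of all
   small types.  It contains a copy of every small type, so it is a proper
   class, and structures on small subsets of it can be compared by literal
   inclusion, as in set theory. *)
Definition V := {A : SmallType & A}.

Definition small_set (X : set V) := exists A : SmallType, X #= [set: A].

Record language := Language {
  relsym : SmallType;
  funsym : SmallType;
  rel_arity : relsym -> nat;
  fun_arity : funsym -> nat }.

(* Functions are interpreted by their graphs: [fun_graph F v y] means
   F(v) = y.  Interpretations hold on tuples of the carrier only (see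
   [is_structure]), so that Leibniz equality of structures is extensional. *)
Record structure (L : language) := Structure {
  carrier : set V;
  rel_interp : forall R : relsym L, set ('I_(rel_arity R) -> V);
  fun_graph : forall F : funsym L, ('I_(fun_arity F) -> V) -> set V }.
Arguments rel_interp {L} s R : rename.
Arguments fun_graph {L} s F : rename.

Definition tuple_in (X : set V) n (v : 'I_n -> V) := forall i, X (v i).

Record is_structure (L : language) (M : structure L) : Prop := IsStructure {
  carrier_small : small_set (carrier M);
  rel_interp_in : forall R v, rel_interp M R v ->
    tuple_in (carrier M) v;
  fun_graph_in : forall F v y, fun_graph M F v y ->
    tuple_in (carrier M) v /\ carrier M y;
  fun_graph_total : forall F v, tuple_in (carrier M) v ->
    exists y, fun_graph M F v y;
  fun_graph_functional : forall F v y y', fun_graph M F v y ->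
    fun_graph M F v y' -> y = y' }.

Definition substructure (L : language) (M N : structure L) : Prop :=
  [/\ carrier M `<=` carrier N,
      forall R v, tuple_in (carrier M) v ->
        (rel_interp M R v <-> rel_interp N R v)
    & forall F v y, tuple_in (carrier M) v ->
        (fun_graph M F v y <-> fun_graph N F v y)].

(* The image f[M], with the structure transported along f; it is only
   meaningful when f is injective on the carrier of M. *)
Definition image_structure (L : language) (f : V -> V) (M : structure L) :
    structure L :=
  {| carrier := f @` carrier M;
     rel_interp := fun R =>
       [set w | exists2 v, rel_interp M R v & w = f \o v];
     fun_graph := fun F w =>
       [set z | exists v y,
         [/\ fun_graph M F v y, w = f \o v & z = f y]] |}.

Definition isomorphism (L : language) (f : V -> V) (M N : structure L) :=
  set_inj (carrier M) f /\ image_structure f M = N.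

Definition isomorphic (L : language) (M N : structure L) :=
  exists f, isomorphism f M N.

Definition union_structure (L : language) (I : Type) (D : set I)
    (M : I -> structure L) : structure L :=
  {| carrier := \bigcup_(i in D) carrier (M i);
     rel_interp := fun R => \bigcup_(i in D) rel_interp (M i) R;
     fun_graph := fun F v =>
       \bigcup_(i in D) fun_graph (M i) F v |}.

Definition strict (I : Type) (le : rel I) (i j : I) := le i j /\ i <> j.

Definition limit_ordinal (I : Type) (le : rel I) : Prop :=
  [/\ well_order le, $|I| & forall i, exists j, strict le i j].

Definition limit_element (I : Type) (le : rel I) (i : I) : Prop :=
  (exists j, strict le j i) /\
  forall j, strict le j i -> exists2 k, strict le j k & strict le k i.

Definition increasing (L : language) (prec : structure L -> structure L -> Prop)
    (I : Type) (le : rel I) (M : I -> structure L) : Prop :=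
  forall i j, strict le i j -> prec (M i) (M j).

Definition continuous_chain (L : language) (I : Type) (le : rel I)
    (M : I -> structure L) : Prop :=
  forall i, limit_element le i ->
    M i = union_structure [set j | strict le j i] M.

Definition LS_property (L : language) (K : set (structure L))
    (prec : structure L -> structure L -> Prop) (kappa : SmallType) : Prop :=
  [/\ infinite_set [set: kappa],
      [set: (relsym L + funsym L)%type] #<= [set: kappa]
    & forall M (A : set V), K M -> A `<=` carrier M ->
        exists M0, [/\ prec M0 M, A `<=` carrier M0
          & carrier M0 #<= [set: (set_type A + kappa)%type]]].

Record AEC (L : language) := MkAEC {
  models :> structure L -> Prop;
  prec : structure L -> structure L -> Prop;
  models_structure : forall M, models M -> is_structure M;
  models_isomorphism : forall f M N,
    models M -> isomorphism f M N -> models N;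
  prec_isomorphism : forall f M N N',
    prec M N -> isomorphism f N N' -> prec (image_structure f M) N';
  prec_models : forall M N, prec M N -> models M /\ models N;
  prec_refl : forall M, models M -> prec M M;
  prec_antisym : forall M N, prec M N -> prec N M -> M = N;
  prec_trans : forall M N P, prec M N -> prec N P -> prec M P;
  prec_substructure : forall M N, prec M N -> substructure M N;
  coherence : forall M0 M1 M2, prec M0 M2 -> prec M1 M2 ->
    substructure M0 M1 -> prec M0 M1;
  chain_union : forall (I : SmallType) (le : rel I) (M : I -> structure L),
    limit_ordinal le -> (forall i, models (M i)) -> increasing prec le M ->
    models (union_structure setT M) /\
    forall i, prec (M i) (union_structure setT M);
  chain_smooth : forall (I : SmallType) (le : rel I) (M : I -> structure L) N,
    limit_ordinal le -> (forall i, models (M i)) -> increasing prec le M ->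
    (forall i, prec (M i) N) -> prec (union_structure setT M) N;
  LS_exists : exists kappa, LS_property models prec kappa }.

Definition is_LS_number (L : language) (K : AEC L) (kappa : SmallType) : Prop :=
  LS_property (models K) (prec K) kappa /\
  forall mu, LS_property (models K) (prec K) mu -> [set: kappa] #<= [set: mu].

Definition LS_le (L : language) (K : AEC L) (lambda : SmallType) : Prop :=
  exists2 kappa, is_LS_number K kappa & [set: kappa] #<= [set: lambda].

Definition models_of_size (L : language) (K : AEC L) (lambda : SmallType) :
    set (structure L) :=
  [set M | K M /\ carrier M #= [set: lambda]].

Definition K_embedding (L : language) (K : AEC L) (f : V -> V)
    (M N : structure L) : Prop :=
  set_inj (carrier M) f /\ prec K (image_structure f M) N.

Definition fixes (L : language) (f : V -> V) (M : structure L) : Prop :=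
  forall x, carrier M x -> f x = x.

(* delta < lambda^+ for the ordinal delta represented by I *)
Definition limit_below_succ (lambda I : SmallType) (le : rel I) : Prop :=
  limit_ordinal le /\ [set: I] #<= [set: lambda].

Definition superlimit (L : language) (K : AEC L) (lambda : SmallType)
    (M : structure L) : Prop :=
  [/\ models_of_size K lambda M,
      forall N, models_of_size K lambda N -> exists f, K_embedding K f N M,
      forall N, models_of_size K lambda N -> prec K M N ->
        exists M', [/\ models_of_size K lambda M', prec K N M', N <> M'
          & isomorphic M' M]
    & forall (I : SmallType) (le : rel I) (Mi : I -> structure L),
        limit_below_succ lambda le -> increasing (prec K) le Mi ->
        (forall i, isomorphic (Mi i) M) ->
        isomorphic (union_structure setT Mi) M].

Definition amalgamation (L : language) (K : AEC L) (lambda : SmallType) : Prop :=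
  forall M0 M1 M2,
    models_of_size K lambda M0 -> models_of_size K lambda M1 ->
    models_of_size K lambda M2 -> prec K M0 M1 -> prec K M0 M2 ->
    exists N f1 f2, [/\ models_of_size K lambda N,
      K_embedding K f1 M1 N, K_embedding K f2 M2 N, fixes f1 M0 & fixes f2 M0].

Definition joint_embedding (L : language) (K : AEC L) (lambda : SmallType) :
    Prop :=
  forall M1 M2, models_of_size K lambda M1 -> models_of_size K lambda M2 ->
    exists N f1 f2, [/\ models_of_size K lambda N,
      K_embedding K f1 M1 N & K_embedding K f2 M2 N].

Definition no_maximal_model (L : language) (K : AEC L) (lambda : SmallType) :
    Prop :=
  forall M, models_of_size K lambda M ->
    exists N, [/\ models_of_size K lambda N, prec K M N & M <> N].

Definition extension_with_point (L : language) (K : AEC L) (lambda : SmallType)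
    (M : structure L) (aN : V * structure L) : Prop :=
  [/\ models_of_size K lambda M, models_of_size K lambda aN.2,
      prec K M aN.2 & carrier aN.2 aN.1].

Definition same_type (L : language) (K : AEC L) (lambda : SmallType)
    (M : structure L) (aN1 aN2 : V * structure L) : Prop :=
  [/\ extension_with_point K lambda M aN1,
      extension_with_point K lambda M aN2
    & exists N f1 f2, [/\ models_of_size K lambda N,
        K_embedding K f1 aN1.2 N /\ K_embedding K f2 aN2.2 N,
        fixes f1 M, fixes f2 M & f1 aN1.1 = f2 aN2.1]].

Definition galois_type (L : language) := set (V * structure L).

(* The equivalence class of (a, N) for [same_type]. *)
Definition gtp (L : language) (K : AEC L) (lambda : SmallType)
    (a : V) (M N : structure L) : galois_type L :=
  [set aN' | same_type K lambda M (a, N) aN'].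

Definition types_over (L : language) (K : AEC L) (lambda : SmallType)
    (M : structure L) : set (galois_type L) :=
  [set p | exists a N, extension_with_point K lambda M (a, N) /\
                       p = gtp K lambda a M N].

Definition nonalgebraic (L : language) (K : AEC L) (lambda : SmallType)
    (M : structure L) (p : galois_type L) : Prop :=
  ~ exists2 a, carrier M a & p = gtp K lambda a M M.

(* p|M0, that is, gtp(a/M0; N) for (a, N) representing p.  Under amalgamation
   all representatives give the same class, so this union is that class. *)
Definition restrict_type (L : language) (K : AEC L) (lambda : SmallType)
    (p : galois_type L) (M0 : structure L) : galois_type L :=
  \bigcup_(aN in p) gtp K lambda aN.1 M0 aN.2.

(* [nf s M0 a M1 M3] says that a is independent from M1 over M0 in M3. *)
Record frame (L : language) := Frame {
  basic : structure L -> set (galois_type L);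
  nf : structure L -> V -> structure L -> structure L -> Prop }.

Definition does_not_fork (L : language) (K : AEC L) (lambda : SmallType)
    (s : frame L) (M0 M1 : structure L) (p : galois_type L) : Prop :=
  basic s M1 p /\
  exists a M3, nf s M0 a M1 M3 /\ p = gtp K lambda a M1 M3.

Record good_frame (L : language) (K : AEC L) (lambda : SmallType)
    (s : frame L) : Prop := GoodFrame {
  good_LS : LS_le K lambda;
  good_nonempty : exists M, models_of_size K lambda M;
  good_superlimit : exists M, superlimit K lambda M;
  good_amalgamation : amalgamation K lambda;
  good_joint_embedding : joint_embedding K lambda;
  good_no_maximal : no_maximal_model K lambda;

  basic_types : forall M p, models_of_size K lambda M -> basic s M p ->
    types_over K lambda M p /\ nonalgebraic K lambda M p;
  basic_invariance : forall f a M N N',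
    extension_with_point K lambda M (a, N) -> isomorphism f N N' ->
    basic s M (gtp K lambda a M N) ->
    basic s (image_structure f M)
      (gtp K lambda (f a) (image_structure f M) N');
  basic_density : forall M N,
    models_of_size K lambda M -> models_of_size K lambda N ->
    prec K M N -> M <> N ->
    exists a, [/\ carrier N a, ~ carrier M a
      & basic s M (gtp K lambda a M N)];
  basic_stability : forall M, models_of_size K lambda M ->
    basic s M #<= [set: lambda];

  nf_domain : forall M0 a M1 M3, nf s M0 a M1 M3 ->
    [/\ [/\ models_of_size K lambda M0, models_of_size K lambda M1
          & models_of_size K lambda M3],
        prec K M0 M1, prec K M1 M3 & carrier M3 a /\ ~ carrier M1 a];
  nf_basic : forall M0 a M1 M3, nf s M0 a M1 M3 ->
    basic s M0 (gtp K lambda a M0 M3) /\ basic s M1 (gtp K lambda a M1 M3);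
  nf_invariance : forall f M0 a M1 M3 M3',
    nf s M0 a M1 M3 -> isomorphism f M3 M3' ->
    nf s (image_structure f M0) (f a) (image_structure f M1) M3';
  nf_monotonicity : forall M0 M0' M1' M1 M3 M3' a,
    nf s M0 a M1 M3 ->
    models_of_size K lambda M0' -> models_of_size K lambda M1' ->
    models_of_size K lambda M3' ->
    prec K M0 M0' -> prec K M0' M1' -> prec K M1' M1 -> prec K M3 M3' ->
    nf s M0' a M1' M3' /\
    forall M3'', models_of_size K lambda M3'' ->
      carrier M1' `|` [set a] `<=` carrier M3'' -> prec K M3'' M3' ->
      nf s M0' a M1' M3'';
  nf_local_character :
    forall (I : SmallType) (le : rel I) (M : I -> structure L) p,
    limit_below_succ lambda le -> (forall i, models_of_size K lambda (M i)) ->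
    increasing (prec K) le M -> continuous_chain le M ->
    basic s (union_structure setT M) p ->
    exists i, does_not_fork K lambda s (M i) (union_structure setT M) p;
  nf_transitivity : forall M0 M1 M2 p,
    models_of_size K lambda M0 -> models_of_size K lambda M1 ->
    models_of_size K lambda M2 -> prec K M0 M1 -> prec K M1 M2 ->
    does_not_fork K lambda s M1 M2 p ->
    does_not_fork K lambda s M0 M1 (restrict_type K lambda p M1) ->
    does_not_fork K lambda s M0 M2 p;
  nf_uniqueness : forall M0 M1 p q,
    models_of_size K lambda M0 -> models_of_size K lambda M1 ->
    prec K M0 M1 ->
    does_not_fork K lambda s M0 M1 p -> does_not_fork K lambda s M0 M1 q ->
    restrict_type K lambda p M0 = restrict_type K lambda q M0 -> p = q;
  nf_symmetry : forall M0 M1 M3 a1 a2,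
    models_of_size K lambda M0 -> models_of_size K lambda M1 ->
    models_of_size K lambda M3 -> prec K M0 M1 -> prec K M1 M3 ->
    carrier M1 a1 -> basic s M0 (gtp K lambda a1 M0 M3) ->
    nf s M0 a2 M1 M3 ->
    exists M2 M3', [/\ models_of_size K lambda M2 /\ models_of_size K lambda M3',
      prec K M0 M2 /\ prec K M2 M3', prec K M3 M3', carrier M2 a2
      & nf s M0 a1 M2 M3'];
  nf_extension : forall M N p,
    models_of_size K lambda M -> models_of_size K lambda N -> prec K M N ->
    basic s M p ->
    exists q, [/\ basic s N q, restrict_type K lambda q M = p
      & does_not_fork K lambda s M N q];
  nf_continuity :
    forall (I : SmallType) (le : rel I) (M : I -> structure L) i0 p,
    limit_below_succ lambda le -> (forall i, models_of_size K lambda (M i)) ->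
    increasing (prec K) le M -> continuous_chain le M ->
    (forall i, le i0 i) ->
    types_over K lambda (union_structure setT M) p ->
    (forall i, basic s (M i) (restrict_type K lambda p (M i)) /\
      does_not_fork K lambda s (M i0) (M i) (restrict_type K lambda p (M i))) ->
    basic s (union_structure setT M) p /\
    does_not_fork K lambda s (M i0) (union_structure setT M) p }.

(* An amalgam (f, g, N') of M1 and N over M in which g(a) does not fork over
   M. *)
Definition nonforking_amalgam (L : language) (K : AEC L) (lambda : SmallType)
    (s : frame L) (a : V) (M N M1 : structure L)
    (f g : V -> V) (N' : structure L) : Prop :=
  [/\ models_of_size K lambda N',
      K_embedding K f M1 N' /\ K_embedding K g N N',
      fixes f M, fixes g M
    & does_not_fork K lambda s M (image_structure f M1)
        (gtp K lambda (g a) (image_structure f M1) N')].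

Definition uniqueness_triple (L : language) (K : AEC L) (lambda : SmallType)
    (s : frame L) (a : V) (M N : structure L) : Prop :=
  [/\ extension_with_point K lambda M (a, N),
      basic s M (gtp K lambda a M N)
    & forall M1 f1 g1 N1 f2 g2 N2,
        models_of_size K lambda M1 -> prec K M M1 ->
        nonforking_amalgam K lambda s a M N M1 f1 g1 N1 ->
        nonforking_amalgam K lambda s a M N M1 f2 g2 N2 ->
        exists N' h1 h2, [/\ models_of_size K lambda N',
          K_embedding K h1 N1 N', K_embedding K h2 N2 N',
          forall x, carrier M1 x -> h1 (f1 x) = h2 (f2 x)
          & forall x, carrier N x -> h1 (g1 x) = h2 (g2 x)]].

Definition weakly_successful (L : language) (K : AEC L) (lambda : SmallType)
    (s : frame L) : Prop :=
  forall M p, models_of_size K lambda M -> basic s M p ->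
    exists N a, p = gtp K lambda a M N /\ uniqueness_triple K lambda s a M N.

(* Main.v *)
(* It is enough to show that nonforking for s1 implies nonforking for s2: the
   converse follows from existence of nonforking extensions for s1 and their
   uniqueness for s2.  Call (M, N) an agreeing pair if every type over N which
   does not s1-fork over M does not s2-fork over M.

   If (b, M, N) is a uniqueness triple of s2, then (M, N) is an agreeing pair.
   Indeed, let Q_n be increasing and N_n a copy of N over M, contained in
   Q_(n+1), whose point b_n is s2-independent from Q_n over M.  If a is
   s1-independent from the union of the Q_n, then by local character a is
   s2-independent from Q_(n+1) over Q_n for some n; by symmetry and transitivity
   b_n is s2-independent over M from a model containing a, and since b_n
   dominates N_n over M, a is s2-independent from N_n over M.  By uniqueness for
   s1, the type of a over N_n is a copy of the given type over N.

   Agreeing pairs compose, and are closed under increasing unions and under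
   shrinking N.  By density of basic types, every proper extension of M can be
   enlarged so that it contains new elements in common with some M' given by a
   uniqueness triple over M; exhausting the elements of N in this way yields an
   agreeing pair (M, N') with N' above N. *)
Require Import Defs.
From mathcomp Require Import all_boot wochoice all_classical.

Set Implicit Arguments.
Unset Strict Implicit.
Unset Printing Implicit Defensive.

Local Open Scope classical_set_scope.
Local Open Scope card_scope.

(** * Cardinals *)

Lemma set_injE T U (A : set T) (f : T -> U) :
  set_inj A f <-> forall x y, A x -> A y -> f x = f y -> x = y.
Proof.
split=> [fI x y Ax Ay|fI x y /set_mem Ax /set_mem Ay]; last exact: fI.
by apply: fI; exact: mem_set.
Qed.

(** The point [u0] supplies values outside [A], so that an injection between sets can be given as a
    total function. *)
Lemma card_le_injP T U (A : set T) (B : set U) (u0 : U) :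
  A #<= B <-> exists2 f : T -> U, set_inj A f & forall x, A x -> B (f x).
Proof.
split.
  move/card_leP/injfunPex => [f _ /set_injE fI].
  pose g x := if pselect (A x) is left Ax then val (f (exist _ x (mem_set Ax))) else u0.
  exists g.
    apply/set_injE => x y Ax Ay; rewrite /g.
    case: pselect => // Ax'; case: pselect => // Ay' /val_inj e.
    by have [] := fI _ _ I I e.
  move=> x Ax; rewrite /g; case: pselect => // Ax'.
  by apply: set_mem; apply: valP.
case=> f /set_injE fI fAB.
apply/card_leP/injfunPex.
have h (x : A) : f (val x) \in B by apply/mem_set/fAB/set_mem/valP.
exists (fun x : A => exist _ (f (val x)) (h x) : B) => //.
apply/set_injE => x y _ _ [] /fI e; apply: val_inj; apply: e; apply: set_mem; exact:
  valP.
Qed.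

Lemma card_leT_injP T U : [set: T] #<= [set: U] <-> exists f : T -> U, injective f.
Proof.
split.
  move/card_leP/injfunPex => [f _ /set_injE fI].
  pose i x : [set: T] := exist _ x (mem_set I).
  exists (fun x => val (f (i x))) => x y /val_inj e.
  by have [] := fI (i x) (i y) I I e.
case=> f fI; apply/card_leP/injfunPex.
exists (fun x : [set: T] => exist _ (f (val x)) (mem_set I) : [set: U]) => //.
by apply/set_injE => x y _ _ [] /fI; exact: val_inj.
Qed.

(** Zorn's lemma for graphs of partial injections from [A] to [B]: a maximal graph is defined on all
    of [A] or covers [B], since otherwise a pair of missed points could be added. *)
Lemma card_le_total T U (A : set T) (B : set U) : A #<= B \/ B #<= A.
Proof.
pose P : set (set (T * U)) := [set G | [/\ G `<=` A `*` B,
  forall x y y', G (x, y) -> G (x, y') -> y = y'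
  & forall x x' y, G (x, y) -> G (x', y) -> x = x']].
have [F FP Ftot|G [[GAB Gf Gi] Gmax]] := @Zorn_bigcup _ P.
  split=> [p [G /FP[+ _ _]]|x y y' [G FG Gxy] [G' FG' Gxy']|x x' y [G FG Gxy] [G' FG'
    Gxy']].
  - by apply.
  - have [s|s] := Ftot _ _ FG FG'.
      by have [_ + _] := FP _ FG'; apply; [exact: s Gxy|].
    by have [_ + _] := FP _ FG; apply; [exact: Gxy|exact: s].
  - have [s|s] := Ftot _ _ FG FG'.
      by have [_ _] := FP _ FG'; apply; [exact: s Gxy|].
    by have [_ _] := FP _ FG; apply; [exact: Gxy|exact: s].
have [Atot|] := pselect (forall x, A x -> exists y, G (x, y)).
  left; have [->//|/set0P[x0 Ax0]] := eqVneq A set0.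
  have [y0 _] := Atot x0 Ax0; apply/(card_le_injP _ _ y0).
  have /choice[f fP] x : exists y, A x -> G (x, y).
    have [/Atot[y]|] := pselect (A x); first by exists y.
    by exists y0.
  exists f => [|x /fP/GAB[]//]; apply/set_injE => x x' /fP + /fP /[swap] <-.
  exact: Gi.
move=> /existsNP[x0 /not_implyP[Ax0 /forallNP x0G]].
have Btot y : B y -> exists x, G (x, y).
  move=> By; apply: contrapT => /forallNP yG; apply: (x0G y).
  case: (Gmax (G `|` [set (x0, y)])).
    split; first by move=> ? ?; left.
    by move=> /(_ (x0, y) (or_intror erefl)); exact: x0G.
  split.
  - by move=> p [/GAB//|->].
  - move=> x z z' [g1|[ex ez]] [g2|[ex' ez']]; first exact: Gf g1 g2.
    + by case: (x0G z); rewrite -ex'.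
    + by case: (x0G z'); rewrite -ex.
    + by rewrite ez ez'.
  - move=> x x' z [g1|[ex ez]] [g2|[ex' ez']]; first exact: Gi g1 g2.
    + by case: (yG x); rewrite -ez'.
    + by case: (yG x'); rewrite -ez.
    + by rewrite ex ex'.
right; apply/(card_le_injP _ _ x0).
have /choice[f fP] y : exists x, B y -> G (x, y).
  have [/Btot[x]|] := pselect (B y); first by exists x.
  by exists x0.
exists f => [|x /fP/GAB[]//]; apply/set_injE => x x' /fP + /fP /[swap] <-.
exact: Gf.
Qed.

(* Zorn's lemma is applied to injections [X * X -> X] with [X] infinite.  If
   [~` X] contained a copy of [X], a given injection could be extended to the
   union of [X] and this copy; so [~` X] injects into [X] for a maximal one. *)
Lemma infinite_square T : infinite_set [set: T] ->
  exists f : T * T -> T, injective f.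
Proof.
elim/Peq: T => T /infiniteP /card_leT_injP[n nI].
pose S := [pred p : (set T) * (T -> T -> T) | 
  `[< [/\ range n `<=` p.1, forall x y, p.1 x -> p.1 y -> p.1 (p.2 x y)
    & forall x y x' y', p.1 x -> p.1 y -> p.1 x' -> p.1 y' -> p.2 x y = p.2 x' y' ->
      x = x' /\ y = y'] >]].
pose R : rel ((set T) * (T -> T -> T)) := fun p q => 
  `[< p.1 `<=` q.1 /\ forall x y, p.1 x -> p.1 y -> p.2 x y = q.2 x y >].
(* The range of [n], with a pairing function copied from [nat], serves as bound of the empty
   chain. *)
have [p0 Sp0] : exists p, p \in S.
  have [g0 g0I] : exists g : nat * nat -> nat, injective g.
    exists pickle; exact: (pcan_inj pickleK).
  have /choice[m mP] x : exists k, (exists k', n k' = x) -> n k = x.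
    have [[k <-]|h] := pselect (exists k', n k' = x); first by exists k.
    by exists 0%N => /h.
  exists (range n, fun x y => n (g0 (m x, m y))).
  apply/asboolP; split => //=; first by move=> x y _ _; exists (g0 (m x, m y)).
  move=> x y x' y' [k _ <-] [l _ <-] [k' _ <-] [l' _ <-] /nI /g0I [].
  have mn j : m (n j) = j by apply: nI; apply: mP; exists j.
  by rewrite !mn => -> ->.
have R_refl : {in S, reflexive R} by move=> p _; apply/asboolP; split.
have R_tr : {in S & &, transitive R}.
  move=> q p r _ _ _ /asboolP[pq Epq] /asboolP[qr Eqr]; apply/asboolP; split.
    exact: subset_trans qr.
  by move=> x y px py; rewrite Epq // Eqr //; exact: pq.
have [C CS /wo_chainW Cch|[X f] /asboolP[/= nX fX fI] Xmax] :=
    @Zorn's_lemma _ R S R_refl R_tr.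
  have [C0|C0] := pselect (exists p, p \in C); last first.
    by exists p0 => // p pC; case: C0; exists p.
  pose X : set T := fun x => exists2 p, p \in C & p.1 x.
  have X2 x y : X x -> X y -> exists p, [/\ p \in C, p.1 x & p.1 y].
    move=> [p pC px] [q qC qy]; case/orP: (Cch p q pC qC) => /asboolP[s _].
      by exists q; split=> //; exact: s.
    by exists p; split=> //; exact: s.
  have /choice[f fP] (xy : T * T) : exists z, forall p, p \in C -> p.1 xy.1 -> p.1
    xy.2 ->
      z = p.2 xy.1 xy.2.
    have [[p [pC px py]]|h] := pselect (exists p, [/\ p \in C, p.1 xy.1 & p.1 xy.2]);
      last first.
      by exists xy.1 => p *; case: h; exists p.
    exists (p.2 xy.1 xy.2) => q qC qx qy.
    by case/orP: (Cch p q pC qC) => /asboolP[_ ->].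
  have ub p : p \in C -> p.1 `<=` X by move=> pC x px; exists p.
  exists (X, fun x y => f (x, y)).
    apply/asboolP; split=> /=.
    - case: C0 => p pC; apply: subset_trans (ub p pC).
      by have /asboolP[] := CS p pC.
    - move=> x y /X2/[apply] -[p [pC px py]].
      rewrite (fP (x, y) p) //; apply: (ub p) => //.
      by have /asboolP[_ + _] := CS p pC; apply.
    - move=> x y x' y' /X2/[apply] -[p [pC px py]] /X2/[apply] -[q [qC qx' qy']].
      have [r [rC rx ry rx' ry']] : exists r, [/\ r \in C, r.1 x, r.1 y, r.1 x' & r.1
        y'].
        case/orP: (Cch p q pC qC) => /asboolP[s _].
          by exists q; split=> //; exact: s.
        by exists p; split=> //; exact: s.
      rewrite !(fP _ r) //=; have /asboolP[_ _] := CS r rC; exact.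
  move=> p pC; apply/asboolP; split=> /=; first exact: ub.
  by move=> x y px py; rewrite (fP _ p).
have n01 : n 0%N <> n 1%N by move/nI.
have Xn k : X (n k) by apply: nX; exists k.
have [le|le] := card_le_total (~` X) X.
  have /(card_le_injP _ _ (n 0%N))[g /set_injE gI gX] := le.
  (* All of [T] injects into [X] by [e]: the tag [n 0] marks the elements of [X] and [n 1] the
     images under [g] of the others. Then [f] pairs inside [X]. *)
  pose e x := if pselect (X x) then f (n 0%N) x else f (n 1%N) (g x).
  have eX x : X (e x) by rewrite /e; case: pselect => /= h; apply: fX => //; exact: gX.
  have eI : injective e.
    move=> x y; rewrite /e; case: pselect => /= hx; case: pselect => /= hy.
    - by move/fI => -[].
    - by move/fI => [] //; exact: gX.
    - by move/fI => [] //; [exact: gX|move=> /esym].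
    - by move/fI => [] //; [exact: gX|exact: gX|move=> _ /gI]; apply.
  exists (fun xy => f (e xy.1) (e xy.2)) => -[x y] [x' y'] /= /fI[] //.
  by move=> /eI -> /eI ->.
have /(card_le_injP _ _ (n 0%N))[g /set_injE gI gX] := le.
pose Y := g @` X.
have /choice[h hP] y : exists x, Y y -> X x /\ g x = y.
  have [[x Xx <-]|Yy] := pselect (Y y); first by exists x.
  by exists y => /Yy.
pose Z := X `|` Y.
have XY x : Y x -> ~ X x by move=> [z /gX + <-].
pose r x := if `[< X x >] then x else h x.
have rX x : Z x -> X (r x).
  by rewrite /r; case: asboolP => // h1 [//|/hP[]].
have rI x y : Z x -> Z y -> `[< X x >] = `[< X y >] -> r x = r y -> x = y.
  rewrite /r; case: asboolP => hx; case: asboolP => hy //.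
  by move=> [//|/hP[_ {2}<-]] [//|/hP[_ {2}<-]] _ ->.
(* [c x y] is one of four tags recording which of [x], [y] lie in [X]. Pairs inside [X] keep their
   value under [f]; any other pair is coded in [X] together with its tag and sent into the copy [Y]
   by [g], so the two kinds of values cannot collide. *)
pose c x y := n (`[< X x >].*2 + `[< X y >])%N.
pose k x y := if `[< X x >] && `[< X y >] then f x y
  else g (f (c x y) (f (r x) (r y))).
have kin x y : Z x -> Z y -> X (f (c x y) (f (r x) (r y))).
  by move=> Zx Zy; apply: (fX _ _ (Xn _)); apply: fX; exact: rX.
have SZ : (Z, k) \in S.
  apply/asboolP; split=> /=; first by move=> x /nX; left.
    move=> x y Zx Zy; rewrite /k; case: ifP => [/andP[/asboolP Xx /asboolP Xy]|_].
      by left; exact: fX.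
    by right; exists (f (c x y) (f (r x) (r y))) => //; exact: kin.
  move=> x y x' y' Zx Zy Zx' Zy'; rewrite /k.
  case: ifP => [/andP[/asboolP Xx /asboolP Xy]|h1]; case:
    ifP => [/andP[/asboolP Xx' /asboolP Xy']|h2].
  - exact: fI.
  - by move=> e; case: (gX _ (kin x' y' Zx' Zy')); rewrite -e; exact: fX.
  - by move=> e; case: (gX _ (kin x y Zx Zy)); rewrite e; exact: fX.
  move=> /gI e; have {}e := e (kin x y Zx Zy) (kin x' y' Zx' Zy').
  have fr u v : Z u -> Z v -> X (f (r u) (r v)).
    by move=> Zu Zv; apply: fX; exact: rX.
  have [/nI ec] := fI _ _ _ _ (Xn _) (fr _ _ Zx Zy) (Xn _) (fr _ _ Zx' Zy') e.
  move=> /(fI _ _ _ _ (rX _ Zx) (rX _ Zy) (rX _ Zx') (rX _ Zy')) [].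
  have [ex ey] : `[< X x >] = `[< X x' >] /\ `[< X y >] = `[< X y' >].
    by move: ec; do 4?case: asboolP.
  by move=> /rI-> // /rI->.
have /asboolP[/= ZX _] : R (Z, k) (X, f).
  apply: Xmax => //; apply/asboolP; split=> /=; first by move=> x; left.
  by move=> x y /asboolP Xx /asboolP Xy; rewrite /k Xx Xy.
by case: (gX _ (Xn 0%N)); apply: ZX; right; exists (n 0%N).
Qed.

(** * Structures and embeddings *)

Lemma structure_ext L (M N : structure L) : carrier M = carrier N ->
  (forall R, rel_interp M R = rel_interp N R) ->
  (forall F v, fun_graph M F v = fun_graph N F v) -> M = N.
Proof.
case: M N => c r f [c' r' f'] /= -> er ef.
by congr Structure; apply/functional_extensionality_dep => ?; [exact: er|apply/funext].
Qed.

Lemma image_structure_eq L (M : structure L) f g : is_structure M ->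
  (forall x, carrier M x -> f x = g x) -> image_structure f M = image_structure g M.
Proof.
move=> HM fg.
have fgv n (v : 'I_n -> V) : tuple_in (carrier M) v -> f \o v = g \o v.
  by move=> vM; apply/funext => i /=; apply/fg/vM.
apply: structure_ext => /=.
- by apply/seteqP; split=> _ [x Mx <-]; exists x; rewrite ?fg.
- by move=> R; apply/seteqP; split=> _ [v vR ->]; exists v => //;
    rewrite fgv //; exact: rel_interp_in vR.
- move=> F w; apply/seteqP; split=> z [v [y [vy -> ->]]]; exists v, y;
    have [vM yM] := fun_graph_in HM vy; by rewrite fgv ?fg.
Qed.

Lemma image_structure_comp L (M : structure L) f g :
  image_structure g (image_structure f M) = image_structure (g \o f) M.
Proof.
apply: structure_ext => /=.
- by rewrite image_comp.
- move=> R; apply/seteqP; split=> w [v].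
    by move=> [u uR ->] ->; exists u.
  by move=> vR ->; exists (f \o v) => //; exists v.
- move=> F w; apply/seteqP; split=> z [v [y]].
    by move=> [[u [x [ux -> ->]]] -> ->]; exists u, x.
  by move=> [vy -> ->]; exists (f \o v), (f y); split=> //; exists v, y.
Qed.

Lemma image_structure_id L (M : structure L) : image_structure id M = M.
Proof.
apply: structure_ext => /=.
- by rewrite image_id.
- by move=> R; apply/seteqP; split=> [_ [v vR ->] //|v vR]; exists v.
- by move=> F w; apply/seteqP; split=> [z [v [y [vy -> ->]]] //|z zw]; exists w, z.
Qed.

Lemma image_structure_fixes L (M : structure L) f :
  is_structure M -> fixes f M -> image_structure f M = M.
Proof.
move=> HM fM; rewrite -[RHS]image_structure_id.
exact: image_structure_eq.
Qed.

Lemma set_inj_comp T U W (A : set T) (f : T -> U) (g : U -> W) :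
  set_inj A f -> set_inj (f @` A) g -> set_inj A (g \o f).
Proof.
move=> /set_injE fI /set_injE gI; apply/set_injE => x y Ax Ay /= e.
by apply: (fI _ _ Ax Ay); apply: (gI _ _ _ _ e); [exists x|exists y].
Qed.

Lemma set_inj_sub T U (A B : set T) (f : T -> U) :
  A `<=` B -> set_inj B f -> set_inj A f.
Proof. by move=> AB /set_injE fI; apply/set_injE => x y /AB + /AB; exact: fI. Qed.

Lemma set_inj_inv T U (A : set T) (f : T -> U) (t0 : T) : set_inj A f ->
  exists g : U -> T, forall x, A x -> g (f x) = x.
Proof.
move=> /set_injE fI.
have /choice[g gP] y : exists x, (exists x', A x' /\ f x' = y) -> A x /\ f x = y.
  by have [[x h]|h] := pselect (exists x, A x /\ f x = y); [exists x|exists t0].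
exists g => x Ax; have [] := gP (f x); first by exists x.
by move=> ? /fI; apply.
Qed.

Lemma card_eq_image_inj T U (A : set T) (f : T -> U) : set_inj A f -> f @` A #= A.
Proof.
by move=> /Pinj[g ->]; exact: card_image.
Qed.

(** Cantor's diagonal argument. *)
Lemma no_injection_powerset T (j : (T -> Prop) -> T) : ~ injective j.
Proof.
move=> jI; pose D x := (exists s, j s = x /\ ~ s x).
have nD : ~ D (j D) by move=> [s [/jI -> sD]]; apply: (sD); exists D.
by apply: (nD); exists D.
Qed.

(** Proof irrelevance makes every proof of [T = T] equal to reflexivity, so transport along it is
    trivial. *)
Lemma existT_V_inj (T : SmallType) (x y : T) :
  existT (fun A : SmallType => A) T x = existT _ T y -> x = y.
Proof.
have cast (v w : V) : v = w -> forall e : projT1 v = projT1 w,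
    eq_rect _ id (projT2 v) _ e = projT2 w.
  by move=> -> e; rewrite (Prop_irrelevance e erefl).
by move=> /cast/(_ erefl).
Qed.

(* The fresh elements are indexed by a type which is larger than the disjoint
   union of all types indexing elements of [X]. *)
Lemma fresh_copies (X Y : set V) : small_set X -> small_set Y ->
  exists2 h : V -> V, set_inj Y h & forall y, ~ X (h y).
Proof.
(* Passing to [option B] provides a default value even if [B] is empty. *)
have small_inj Z (B : SmallType) : Z #= [set: B] ->
    exists k : V -> option B, set_inj Z k.
  move=> /card_eqPle[ZB _]; have : Z #<= [set: option B].
    by apply: card_le_trans ZB _; apply/card_leT_injP; exists Some => ? ? [].
  by move/(card_le_injP _ _ None) => [k kI _]; exists k.
move=> [B /small_inj[g gI]] [C /small_inj[k /set_injE kI]].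
have [f fP] := set_inj_inv (existT (fun A : SmallType => A) unit tt : V) gI.
pose S := {b : option B & projT1 (f b)}.
pose T : SmallType := ((S -> Prop) * option C)%type.
exists (fun y => existT (fun A : SmallType => A) T (fun=> False, k y)).
  by apply/set_injE => x y Yx Yy e; apply: kI => //; exact:
    (congr1 snd (existT_V_inj e)).
(* If [h y] were in [X], then [T] would be one of the types summed up in [S], and the power set of
   [S], being a factor of [T], would inject into [S]. *)
move=> y /fP; move: (g _) => b fb.
have [j jI] : exists j : T -> projT1 (f b), injective j.
  by rewrite fb; exists id.
apply: (@no_injection_powerset S (fun s => existT _ b (j (s, None)))).
have [r rK] : exists r : S -> projT1 (f b), forall t, r (existT _ b t) = t.
  exists (fun s => if pselect (projT1 s = b) is left e
    then eq_rect _ (fun b => projT1 (f b)) (projT2 s) _ e else j (fun=> False, None)).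
  move=> t /=; case: pselect => // e.
  by rewrite (Prop_irrelevance e erefl).
by move=> s s' /(congr1 r); rewrite !rK => e; exact: (congr1 fst (jI _ _ e)).
Qed.

(** * Embeddings of models *)

Section models.
Context (L : language) (K : AEC L).
Implicit Types (M N P : structure L) (f g h : V -> V).

Lemma isomorphism_image f M : set_inj (carrier M) f -> isomorphism f M
  (image_structure f M).
Proof. by []. Qed.

Lemma isomorphism_inv f M N : is_structure M -> isomorphism f M N ->
  exists g, [/\ isomorphism g N M, forall x, carrier M x -> g (f x) = x
    & forall y, carrier N y -> f (g y) = y].
Proof.
move=> HM [fI <-]; have [g gP] := set_inj_inv (existT (fun A :
  SmallType => A) unit tt : V) fI.
exists g; split=> //; last by move=> _ [x Mx <-]; rewrite gP.
split; last by rewrite image_structure_comp image_structure_fixes.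
by apply/set_injE => _ _ [x Mx <-] [y My <-]; rewrite !gP // => ->.
Qed.

Lemma prec_carrier M N : prec K M N -> carrier M `<=` carrier N.
Proof. by case/prec_substructure. Qed.

Lemma prec_models_l M N : prec K M N -> K M. Proof. by case/prec_models. Qed.
Lemma prec_models_r M N : prec K M N -> K N. Proof. by case/prec_models. Qed.

Lemma models_image f M : K M -> set_inj (carrier M) f -> K (image_structure f M).
Proof. by move=> KM fI; apply: models_isomorphism KM (isomorphism_image fI). Qed.

Lemma prec_image f M N : prec K M N -> set_inj (carrier N) f ->
  prec K (image_structure f M) (image_structure f N).
Proof. by move=> MN fI; apply: prec_isomorphism MN (isomorphism_image fI). Qed.

Lemma K_embedding_models f M N : K_embedding K f M N -> K (image_structure f M) /\ K N.
Proof. by move=> [_ /prec_models]. Qed.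

Lemma K_embedding_carrier f M N x : K_embedding K f M N -> carrier M x -> carrier N
  (f x).
Proof. by move=> [_ /prec_carrier fMN] Mx; apply: fMN; exists x. Qed.

Lemma K_embedding_iso f M N : K N -> isomorphism f M N -> K_embedding K f M N.
Proof. by move=> KN [fI fM]; split=> //; rewrite fM; exact: prec_refl. Qed.

Lemma K_embedding_id M N : prec K M N -> K_embedding K id M N.
Proof. by move=> MN; split; [move=> ? ? _ _|rewrite image_structure_id]. Qed.

Lemma K_embedding_comp f g M N P :
  K_embedding K f M N -> K_embedding K g N P -> K_embedding K (g \o f) M P.
Proof.
move=> [fI fMN] [gI gNP]; split.
  apply: set_inj_comp => //; apply: set_inj_sub gI; exact: prec_carrier fMN.
rewrite -image_structure_comp; apply: prec_trans gNP; exact: prec_image.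
Qed.

Lemma K_embedding_restrict f M0 M N : prec K M0 M -> K_embedding K f M N ->
  K_embedding K f M0 N.
Proof. by move=> /K_embedding_id/K_embedding_comp h /h. Qed.

Lemma K_embedding_extend f M N P : K_embedding K f M N -> prec K N P -> K_embedding K
  f M P.
Proof. by move=> fMN /K_embedding_id; exact: K_embedding_comp. Qed.

(** Turns embeddings into inclusions: in [N], the elements of [f[M]] are renamed to their preimages
    and the others to fresh elements outside [M]. *)
Lemma K_embedding_extension f M N : K M -> K_embedding K f M N ->
  exists h N', [/\ isomorphism h N N', prec K M N'
    & forall x, carrier M x -> h (f x) = x].
Proof.
move=> KM fMN; have [fI fMprec] := fMN.
have [g gf] := set_inj_inv (existT (fun A : SmallType => A) unit tt : V) fI.
have KN := prec_models_r fMprec.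
have [k /set_injE kI kM] := fresh_copies (carrier_small (models_structure KM))
  (carrier_small (models_structure KN)).
pose h y := if pselect ((f @` carrier M) y) then g y else k y.
have hf x : carrier M x -> h (f x) = x.
  move=> Mx; rewrite /h; case: pselect => /= [_|nfx]; first exact: gf.
  by case: nfx; exists x.
have hI : set_inj (carrier N) h.
  apply/set_injE => y z Ny Nz; rewrite /h.
  case: pselect => /= [[x Mx fx]|_]; case: pselect => /= [[x' Mx' fx']|_].
  - by rewrite -fx -fx' !gf // => ->.
  - by rewrite -fx gf // => e; case: (kM z); rewrite -e.
  - by rewrite -fx' gf // => e; case: (kM y); rewrite e.
  - exact: kI.
exists h, (image_structure h N); split=> //.
have hfM : image_structure (h \o f) M = M.
  exact: (image_structure_fixes (models_structure KM)).
by rewrite -{1}hfM -image_structure_comp; exact: prec_image.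
Qed.

End models.

(** * Well-orders and unions of chains *)

Section well_orders.
Context (I : Type) (le : rel I).
Hypothesis wo : well_order le.

Lemma wo_min (A : set I) : A !=set0 -> exists2 z, A z & forall x, A x -> le z x.
Proof.
move=> [x Ax]; have [|z [[/set_mem Az zmin] _]] := wo (A := mem A).
  by exists x; exact: mem_set.
by exists z => // y Ay; apply: zmin; exact: mem_set.
Qed.

Lemma wo_total x y : le x y \/ le y x.
Proof.
have [|z [->|->] h] := @wo_min [set x; y]; first by exists x; left.
  by left; apply: h; right.
by right; apply: h; left.
Qed.

Lemma wo_refl x : le x x.
Proof. by case: (wo_total x x). Qed.

(** Minima in a well-order are unique, and here both [x] and [y] are minima of the set they form. *)
Lemma wo_antisym x y : le x y -> le y x -> x = y.
Proof.
move=> xy yx; pose A : set I := [set x; y].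
have [|z [_ zU]] := wo (A := mem A); first by exists x; apply/mem_set; left.
have lbA w : A w -> le w x -> le w y -> minimum_of le (mem A) w.
  by move=> Aw wx wy; split; [exact: mem_set|move=> u /set_mem[->|->]].
by rewrite -(zU x) ?(zU y) //; apply: lbA => //; [right|exact: wo_refl|left|exact:
  wo_refl].
Qed.

Lemma wo_trans x y z : le x y -> le y z -> le x z.
Proof.
move=> xy yz; have [|w [[->|->]|->] h] := @wo_min [set x; y; z].
- by exists x; left; left.
- by apply: h; right.
- by rewrite (wo_antisym xy) //; apply: h; left; left.
- by rewrite -(wo_antisym yz) //; apply: h; left; right.
Qed.

Lemma strictP x y : strict le x y <-> ~ le y x.
Proof.
split=> [[xy +] yx|nyx]; first by apply; exact: wo_antisym.
split; first by case: (wo_total x y).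
by move=> e; apply: nyx; rewrite e; exact: wo_refl.
Qed.

Lemma strict_wf : well_founded (strict le).
Proof.
move=> x; apply: contrapT => nx.
have [|z nz zmin] := @wo_min [set x | ~ Acc (strict le) x]; first by exists x.
apply: nz; constructor => y yz; apply: contrapT => ny.
by move/strictP: yz; apply; exact: zmin.
Qed.

Definition suborder (D : set I) : rel {x | D x} := fun x y => le (sval x) (sval y).

Lemma suborder_strict (D : set I) x y : strict (suborder (D := D)) x y <-> strict le
  (sval x) (sval y).
Proof.
case: x y => [x Dx] [y Dy]; split=> [[xy nxy]|[xy nxy]]; split=> //= e.
  by apply: nxy; exact: eq_exist.
by apply: nxy; case: e.
Qed.

Lemma suborder_wo (D : set I) : well_order (suborder (D := D)).
Proof.
move=> A [x Ax].
have [|_ [y /= Ay <-] ymin] := @wo_min [set sval y | y in [set y | y \in A]].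
  by exists (sval x), x.
exists y; split; first by split=> // z Az; apply: ymin; exists z.
move=> z [Az zmin]; have e : sval y = sval z.
  by apply: wo_antisym; [apply: ymin; exists z|exact: zmin].
by case: y z e {Ay ymin Az zmin} => [y Dy] [z Dz] /= e; exact: eq_exist.
Qed.

Lemma wo_limit_ordinal : [set: I] !=set0 -> (forall i, exists j, strict le i j) ->
  limit_ordinal le.
Proof. by move=> [i _] h; split=> //; exact: squash i. Qed.

End well_orders.

Lemma exists_well_order (T : Type) : exists le : rel T, well_order le.
Proof. by elim/Peq: T => T; have [le] := well_ordering_principle T; exists le. Qed.

Lemma nat_wo : well_order leq.
Proof.
move=> A A0; have A0' : exists n, A n by [].
have [m Am mmin] := ex_minnP A0'.
exists m; split; first by split=> // k; exact: mmin.
move=> k [Ak kmin]; apply/eqP; rewrite eqn_leq.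
by rewrite (mmin _ Ak) (kmin _ Am).
Qed.

Lemma strict_leqP m n : strict leq m n <-> (m < n)%N.
Proof.
split=> [[mn /eqP ne]|]; first by rewrite ltn_neqAle ne mn.
by rewrite ltn_neqAle => /andP[/eqP ne mn]; split.
Qed.

Lemma nat_limit_ordinal : limit_ordinal leq.
Proof.
split; [exact: nat_wo|exact: squash 0%N|move=> n].
by exists n.+1; apply/strict_leqP.
Qed.

(** Hence every chain indexed by [nat] is continuous. *)
Lemma nat_no_limit_element n : ~ limit_element leq n.
Proof.
case=> -[j /strict_leqP]; case: n => // n _ /(_ n)[|k].
  exact/strict_leqP.
by move=> /strict_leqP nk /strict_leqP; rewrite ltnS leqNgt nk.
Qed.

Section unions.
Context (L : language).
Implicit Types (M N P : structure L).

(** Plain inclusion of all interpretations. Unions are least upper bounds for this order, so two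
    unions can be proved equal by mutual cofinality and antisymmetry. *)
Definition sub_interp M N := [/\ carrier M `<=` carrier N,
  forall R, rel_interp M R `<=` rel_interp N R
  & forall F v, fun_graph M F v `<=` fun_graph N F v].

Lemma sub_interp_refl M : sub_interp M M.
Proof. by split=> *. Qed.

Lemma sub_interp_antisym M N : sub_interp M N -> sub_interp N M -> M = N.
Proof.
by move=> [c r f] [c' r' f']; apply: structure_ext => *; apply/seteqP; split.
Qed.

Lemma sub_interp_trans M N P : sub_interp M N -> sub_interp N P -> sub_interp M P.
Proof.
move=> [c r f] [c' r' f']; split; first exact: subset_trans c c'.
  by move=> R; exact: subset_trans (r R) (r' R).
by move=> F v; exact: subset_trans (f F v) (f' F v).
Qed.

Lemma sub_interp_union I (D : set I) (M : I -> structure L) i : D i ->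
  sub_interp (M i) (union_structure D M).
Proof. by move=> Di; split=> /= [x|R v|F v y] ?; exists i. Qed.

Lemma union_sub_interp I (D : set I) (M : I -> structure L) N :
  (forall i, D i -> sub_interp (M i) N) -> sub_interp (union_structure D M) N.
Proof. by move=> h; split=> *; apply: bigcup_sub => i /h[]. Qed.

Lemma union_structure_cofinal I J (D : set I) (E : set J) (M : I -> structure L)
    (N : J -> structure L) :
  (forall i, D i -> exists2 j, E j & sub_interp (M i) (N j)) ->
  (forall j, E j -> exists2 i, D i & sub_interp (N j) (M i)) ->
  union_structure D M = union_structure E N.
Proof.
move=> h1 h2; apply: sub_interp_antisym; apply: union_sub_interp => i.
  by move=> /h1[j Ej ij]; apply: sub_interp_trans ij _; exact: sub_interp_union.
by move=> /h2[j Ej ij]; apply: sub_interp_trans ij _; exact: sub_interp_union.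
Qed.

Lemma union_structure_max I (D : set I) (M : I -> structure L) m : D m ->
  (forall i, D i -> sub_interp (M i) (M m)) -> union_structure D M = M m.
Proof.
move=> Dm h; apply: sub_interp_antisym; first exact: union_sub_interp.
exact: sub_interp_union.
Qed.

Context (K : AEC L).

Lemma prec_sub_interp M N : prec K M N -> sub_interp M N.
Proof.
move=> MN; have [c r f] := prec_substructure MN.
have HM := models_structure (prec_models_l MN); split=> //.
  by move=> R v vR; apply/(r R v (rel_interp_in HM vR)).
by move=> F v y vy; apply/(f F v y (fun_graph_in HM vy).1).
Qed.

Section chains.
Context (I : SmallType) (le : rel I) (D : set I) (M : I -> structure L).
Hypothesis wo : well_order le.
Hypothesis D0 : D !=set0.
Hypothesis KM : forall i, D i -> K (M i).
Hypothesis incM : forall i j, D i -> D j -> strict le i j -> prec K (M i) (M j).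

Lemma chain_prec i j : D i -> D j -> le i j -> prec K (M i) (M j).
Proof.
move=> Di Dj ij; have [<-|ne] := pselect (i = j); first exact/prec_refl/KM.
by apply: incM.
Qed.

(** The chain axioms of an AEC only speak of limit ordinals. For any other nonempty index set the
    union is the last model of the chain. *)
Lemma chain_max_or_limit :
  (exists2 m, D m & forall i, D i -> le i m) \/ limit_ordinal (suborder le (D := D)).
Proof.
have [h|h] := pselect (exists2 m, D m & forall i, D i -> le i m); first by left.
right; apply: wo_limit_ordinal; first exact: suborder_wo.
  by have [i Di] := D0; exists (exist _ i Di).
move=> [i Di]; apply: contrapT => nj; apply: h; exists i => // j Dj.
have [//|ji] := wo_total wo j i.
apply: contrapT => /(strictP wo) ij; apply: nj; exists (exist _ j Dj).
exact/suborder_strict.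
Qed.

Lemma union_suborder : union_structure D M = union_structure setT (fun i :
  {x | D x} => M (sval i)).
Proof.
apply: union_structure_cofinal => [i Di|[i Di] _].
  by exists (exist _ i Di) => //; exact: sub_interp_refl.
by exists i => //; exact: sub_interp_refl.
Qed.

Lemma chain_union_models : K (union_structure D M) /\
  forall i, D i -> prec K (M i) (union_structure D M).
Proof.
have [[m Dm mmax]|lim] := chain_max_or_limit.
  rewrite (@union_structure_max _ _ _ m) // => [|i Di].
    by split=> [|i Di]; [exact: KM|apply: chain_prec => //; exact: mmax].
  by apply: prec_sub_interp; apply: chain_prec => //; exact: mmax.
have [] := @chain_union _ K _ _ (fun i : {x | D x} => M (sval i)) lim.
- by move=> [i Di]; exact: KM.
- by move=> [i Di] [j Dj] /suborder_strict; exact: incM.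
rewrite -union_suborder => KU h; split=> // i Di.
exact: (h (exist _ i Di)).
Qed.

Lemma chain_union_prec N : (forall i, D i -> prec K (M i) N) ->
  prec K (union_structure D M) N.
Proof.
move=> MN; have [[m Dm mmax]|lim] := chain_max_or_limit.
  rewrite (@union_structure_max _ _ _ m) // => [|i Di]; first exact: MN.
  by apply: prec_sub_interp; apply: chain_prec => //; exact: mmax.
rewrite union_suborder; apply: chain_smooth lim _ _ _.
- by move=> [i Di]; exact: KM.
- by move=> [i Di] [j Dj] /suborder_strict; exact: incM.
- by move=> [i Di]; exact: MN.
Qed.

(** A point of the union is coded by an index of a model containing it and its code in that model;
    pairs from [lambda] are coded back in [lambda]. *)
Lemma chain_union_sized (lambda : SmallType) : infinite_set [set: lambda] ->
  [set: I] #<= [set: lambda] -> (forall i, D i -> models_of_size K lambda (M i)) ->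
  models_of_size K lambda (union_structure D M).
Proof.
move=> inf /card_leT_injP[e eI] sM; have [KU KMU] := chain_union_models.
split=> //; have [i0 Di0] := D0; apply/card_eqPle; split; last first.
  have [_ /card_eqPle[_ c]] := sM _ Di0; apply: card_le_trans c _.
  exact: subset_card_le (prec_carrier (KMU _ Di0)).
have [l0 _] := infinite_setN0 inf.
have [sq sqI] := infinite_square inf.
have /choice[c cP] i : exists c : V -> lambda, D i -> set_inj (carrier (M i)) c.
  have [Di|nDi] := pselect (D i); last by exists (fun=> l0).
  have [_ /card_eqPle[/(card_le_injP _ _ l0)[c cI _] _]] := sM _ Di.
  by exists c.
have /choice[ix ixP] x : exists i, carrier (union_structure D M) x -> D i /\ carrier
  (M i) x.
  have [[i Di Mix]|nx] := pselect (carrier (union_structure D M) x); last by exists i0.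
  by exists i.
apply/(card_le_injP _ _ l0); exists (fun x => sq (e (ix x), c (ix x) x)) => //.
apply/set_injE => x y Ux Uy /sqI [/eI exy].
have [Dx Mx] := ixP _ Ux; have [Dy My] := ixP _ Uy.
move: Mx My Dx; rewrite exy => Mx My Dx /(proj1 (set_injE _ _) (cP _ Dx) _ _ Mx My).
by [].
Qed.

End chains.
End unions.

(** * Galois types and nonforking *)

Section types.
Context (L : language) (K : AEC L) (lambda : SmallType).
Hypothesis AP : amalgamation K lambda.
Implicit Types (M N P Q : structure L) (a b : V).

Local Notation sized := (models_of_size K lambda).
Local Notation ext := (extension_with_point K lambda).
Local Notation tp := (gtp K lambda).

Lemma sized_image f M : sized M -> set_inj (carrier M) f -> sized (image_structure f M).
Proof.
move=> [KM cM] fI; split; first exact: models_image.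
exact: card_eq_trans (card_eq_image_inj fI) cM.
Qed.

Lemma sized_isomorphism f M N : sized M -> isomorphism f M N -> sized N.
Proof. by move=> sM [fI <-]; exact: sized_image. Qed.

Lemma sized_structure M : sized M -> is_structure M.
Proof. by case=> /models_structure. Qed.

Lemma image_sized_fixes M f : sized M -> fixes f M -> image_structure f M = M.
Proof. by move=> /sized_structure; exact: image_structure_fixes. Qed.

Lemma fixes_sub f M N : prec K M N -> fixes f N -> fixes f M.
Proof. by move=> /prec_carrier MN fN x /MN; exact: fN. Qed.

Lemma K_embedding_prec f M N P : sized M -> prec K M N -> fixes f M ->
  K_embedding K f N P -> prec K M P.
Proof.
move=> sM MN fM [fI fNP]; apply: prec_trans fNP.
by rewrite -(image_sized_fixes sM fM); exact: prec_image.
Qed.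

Lemma amalgamation_extension M0 M1 M2 : sized M0 -> sized M1 -> sized M2 ->
  prec K M0 M1 -> prec K M0 M2 ->
  exists N g, [/\ sized N, prec K M1 N, K_embedding K g M2 N & fixes g M0].
Proof.
move=> s0 s1 s2 M01 M02.
have [N [f1 [f2 [sN f1N f2N fix1 fix2]]]] := AP s0 s1 s2 M01 M02.
have [h [N' [hN M1N' hf1]]] := K_embedding_extension s1.1 f1N.
have sN' := sized_isomorphism sN hN.
exists N', (h \o f2); split=> //.
  by apply: K_embedding_comp f2N _; exact: K_embedding_iso sN'.1 hN.
move=> x M0x /=; rewrite fix2 // -{1}(fix1 x) // hf1 //.
exact: (prec_carrier M01).
Qed.

Lemma ext_embedding f a M N P : ext M (a, N) -> sized P -> K_embedding K f N P ->
  fixes f M -> ext M (f a, P).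
Proof.
move=> [/= sM sN MN Na] sP fNP fM; split=> //=; first exact: K_embedding_prec fNP.
exact: K_embedding_carrier fNP _.
Qed.

Lemma ext_restrict a M0 M N : sized M0 -> prec K M0 M -> ext M (a, N) -> ext M0 (a, N).
Proof. by move=> s0 M0M [/= sM sN MN Na]; split=> //=; exact: prec_trans MN. Qed.

(** By renaming, the common extension can be taken above [N] itself, so that only [N'] is moved. *)
Lemma same_typeP M a N b N' : same_type K lambda M (a, N) (b, N') <->
  [/\ ext M (a, N), ext M (b, N') & exists P g,
    [/\ sized P, prec K N P, K_embedding K g N' P, fixes g M & g b = a]].
Proof.
split=> [[aN bN' [P [f1 [f2 [sP [/= f1P f2P] fix1 fix2 e]]]]]|]; last first.
  move=> [aN bN' [P [g [sP NP gP gM gb]]]]; split=> //; exists P, id, g; split=> //=.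
  by split=> //; exact: K_embedding_id.
split=> //; case: aN => [/= sM sN MN Na].
have [h [Q [hQ NQ hf1]]] := K_embedding_extension sN.1 f1P.
have sQ := sized_isomorphism sP hQ.
exists Q, (h \o f2); split=> //=; last by rewrite -e hf1.
  by apply: K_embedding_comp f2P _; exact: K_embedding_iso sQ.1 hQ.
move=> x Mx /=; rewrite fix2 // -{1}(fix1 x) // hf1 //.
exact: (prec_carrier MN).
Qed.

Lemma same_type_refl M aN : ext M aN -> same_type K lambda M aN aN.
Proof.
case: aN => a N aN; apply/same_typeP; split=> //; exists N, id.
case: aN => /= sM sN MN Na; split=> //; first exact: prec_refl sN.1.
exact: K_embedding_id (prec_refl sN.1).
Qed.

Lemma same_type_sym M aN bN : same_type K lambda M aN bN -> same_type K lambda M bN aN.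
Proof.
move=> [aN' bN' [P [f1 [f2 [sP [f1P f2P] fix1 fix2 e]]]]]; split=> //.
by exists P, f2, f1; split.
Qed.

(** Amalgamation enters here: the first witness is renamed so as to contain the middle model [N2],
    and is then amalgamated with the second one over [N2]. *)
Lemma same_type_trans M aN bN cN : same_type K lambda M aN bN ->
  same_type K lambda M bN cN -> same_type K lambda M aN cN.
Proof.
case: aN bN cN => [a N1] [b N2] [c N3].
move=> /same_typeP[aN1 bN2 [P [g [sP N1P gP gM gb]]]].
move=> /same_typeP[_ cN3 [Q [k [sQ N2Q kQ kM kc]]]].
case: (bN2) => /= sM sN2 MN2 N2b.
have [h [P' [hP N2P' hg]]] := K_embedding_extension sN2.1 gP.
have sP' := sized_isomorphism sP hP.
have [R [e [sR P'R eR eN2]]] := amalgamation_extension sN2 sP' sQ N2P' N2Q.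
split=> //; exists R, h, (e \o k); split=> //=.
- split; last exact: K_embedding_comp kQ eR.
  apply: K_embedding_extend P'R; apply: K_embedding_restrict N1P _.
  exact: K_embedding_iso sP'.1 hP.
- move=> x Mx; rewrite -{1}(gM x) // hg //; exact: (prec_carrier MN2).
- move=> x Mx /=; rewrite kM // eN2 //; exact: (prec_carrier MN2).
- by rewrite -gb hg // kc eN2.
Qed.

Lemma gtpP M a N b N' : ext M (b, N') ->
  tp a M N = tp b M N' <-> same_type K lambda M (a, N) (b, N').
Proof.
move=> bN'; split=> [e|e].
  by have : tp b M N' (b, N') by [exact: same_type_refl]; rewrite -e.
apply/seteqP; split=> cN.
  by apply: same_type_trans; exact: same_type_sym.
exact: same_type_trans.
Qed.

Lemma gtp_eq_amalgam M a N b N' : ext M (b, N') -> tp a M N = tp b M N' ->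
  exists P g, [/\ sized P, prec K N P, K_embedding K g N' P, fixes g M & g b = a].
Proof. by move=> bN' /(gtpP _ _ bN')/same_typeP[]. Qed.

Lemma gtp_embedding g M b N P : ext M (b, N) -> sized P -> K_embedding K g N P ->
  fixes g M -> tp (g b) M P = tp b M N.
Proof.
move=> bN sP gP gM; apply/gtpP => //; apply/same_typeP; split=> //.
  exact: ext_embedding gP gM.
by exists P, g; split=> //; exact: prec_refl sP.1.
Qed.

Lemma gtp_prec M b N P : ext M (b, N) -> sized P -> prec K N P -> tp b M P = tp b M N.
Proof. by move=> bN sP /K_embedding_id NP; exact: (gtp_embedding bN sP NP). Qed.

Lemma gtp_restrict_eq M0 M a N b N' : sized M0 -> prec K M0 M -> ext M (b, N') ->
  tp a M N = tp b M N' -> tp a M0 N = tp b M0 N'.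
Proof.
move=> s0 M0M bN' /(gtpP _ _ bN') [aN _ [P [f1 [f2 [sP fP fix1 fix2 e]]]]].
apply/gtpP; first exact: ext_restrict bN'.
split; [exact: ext_restrict aN|exact: ext_restrict bN'|].
by exists P, f1, f2; split=> //; exact: fixes_sub M0M _.
Qed.

Lemma restrict_gtp M0 M a N : sized M0 -> prec K M0 M -> ext M (a, N) ->
  restrict_type K lambda (tp a M N) M0 = tp a M0 N.
Proof.
move=> s0 M0M aN; apply/seteqP; split=> [cP [[b N'] /= h]|cP h].
  have [_ bN' _] := h.
  by rewrite (gtp_restrict_eq s0 M0M bN' (iffRL (gtpP _ _ bN') h)).
by exists (a, N) => //; exact: same_type_refl.
Qed.

End types.

(** * Nonforking in one good frame *)

Section nonforking.
Context (L : language) (K : AEC L) (lambda : SmallType) (s : frame L).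
Hypothesis G : good_frame K lambda s.
Implicit Types (M N P Q : structure L) (a b : V).

Local Notation sized := (models_of_size K lambda).
Local Notation ext := (extension_with_point K lambda).
Local Notation tp := (gtp K lambda).
Let AP := good_amalgamation G.

Lemma nf_ext M0 a M1 M3 : nf s M0 a M1 M3 -> ext M1 (a, M3).
Proof. by move/(nf_domain G) => [[s0 s1 s3] M01 M13 [M3a _]]; split. Qed.

Lemma nf_ext0 M0 a M1 M3 : nf s M0 a M1 M3 -> ext M0 (a, M3).
Proof.
move=> h; have [[s0 _ _] M01 _ _] := nf_domain G h.
exact: ext_restrict (nf_ext h).
Qed.

Lemma nf_up M0 a M1 M3 P : nf s M0 a M1 M3 -> sized P -> prec K M3 P -> nf s M0 a M1 P.
Proof.
move=> h sP M3P; have [[s0 s1 s3] M01 M13 _] := nf_domain G h.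
by have [] := nf_monotonicity G h s0 s1 sP (prec_refl s0.1) M01 (prec_refl s1.1) M3P.
Qed.

Lemma nf_down M0 a M1 M3 P : nf s M0 a M1 P -> ext M1 (a, M3) -> prec K M3 P ->
  nf s M0 a M1 M3.
Proof.
move=> h [/= _ s3 M13 M3a] M3P; have [[s0 s1 sP] M01 M1P _] := nf_domain G h.
have [_] := nf_monotonicity G h s0 s1 sP (prec_refl s0.1) M01 (prec_refl s1.1)
  (prec_refl sP.1).
by apply=> // x [/(prec_carrier M13)//|->].
Qed.

Lemma nf_between M0 M0' M1' M1 a M3 : nf s M0 a M1 M3 -> sized M0' -> sized M1' ->
  prec K M0 M0' -> prec K M0' M1' -> prec K M1' M1 -> nf s M0' a M1' M3.
Proof.
move=> h s0' s1' p1 p2 p3; have [[_ _ s3] _ _ _] := nf_domain G h.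
by have [] := nf_monotonicity G h s0' s1' s3 p1 p2 p3 (prec_refl s3.1).
Qed.

Lemma nf_image g M0 a M1 M3 P : nf s M0 a M1 M3 -> sized P -> K_embedding K g M3 P ->
  nf s (image_structure g M0) (g a) (image_structure g M1) P.
Proof.
move=> h sP [gI gP].
exact: nf_up (nf_invariance G h (isomorphism_image gI)) sP gP.
Qed.

(** [P] is cut down to [g[M3]], and invariance is applied to the inverse of the isomorphism from
    [M3] onto it. *)
Lemma nf_image_inv g M0 a M1 M3 P : sized M0 -> prec K M0 M1 -> ext M1 (a, M3) ->
  K_embedding K g M3 P ->
  nf s (image_structure g M0) (g a) (image_structure g M1) P -> nf s M0 a M1 M3.
Proof.
move=> s0 M01 [/= s1 s3 M13 M3a] [gI gP] h.
have s3' := sized_image s3 gI.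
have {}h : nf s (image_structure g M0) (g a) (image_structure g M1) (image_structure
  g M3).
  apply: nf_down h _ gP; split=> //=.
  - by apply: sized_image s1 (set_inj_sub _ gI); exact: (prec_carrier M13).
  - exact: prec_image.
  - by exists a.
have [k [kiso kg _]] := isomorphism_inv (sized_structure s3) (isomorphism_image gI).
have := nf_invariance G h kiso.
rewrite !image_structure_comp kg // !(@image_sized_fixes _ K lambda) // => x.
  by move=> /(prec_carrier M13)/kg.
by move=> /(prec_carrier M01)/(prec_carrier M13)/kg.
Qed.

(** Nonforking depends on the type over [M1] only: an extension of [M3] receives a copy of [N] over
    [M1] in which [b] becomes [a]. *)
Lemma nf_gtp M0 a M1 M3 b N : nf s M0 a M1 M3 -> ext M1 (b, N) ->
  tp a M1 M3 = tp b M1 N -> nf s M0 b M1 N.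
Proof.
move=> h bN e; have [P [g [sP M3P gP gM1 gb]]] := gtp_eq_amalgam AP bN e.
have [[s0 s1 s3] M01 M13 _] := nf_domain G h.
apply: nf_image_inv gP _ => //; rewrite gb !(@image_sized_fixes _ K lambda) //.
  exact: nf_up h sP M3P.
exact: fixes_sub M01 gM1.
Qed.

Lemma does_not_forkP M0 a M1 M3 : ext M1 (a, M3) ->
  does_not_fork K lambda s M0 M1 (tp a M1 M3) <-> nf s M0 a M1 M3.
Proof.
move=> aM3; split=> [[_ [b [N [h e]]]]|h]; first exact: nf_gtp h aM3 (esym e).
by split; [have [] := nf_basic G h|exists a, M3].
Qed.

Lemma nf_trans M0 a M1 M2 M3 : nf s M0 a M1 M3 -> nf s M1 a M2 M3 -> nf s M0 a M2 M3.
Proof.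
move=> h01 h12; have [[s0 s1 _] M01 _ _] := nf_domain G h01.
have [[_ s2 _] M12 _ _] := nf_domain G h12.
apply/(does_not_forkP _ (nf_ext h12)); apply: (nf_transitivity G s0 s1 s2 M01 M12).
  exact/(does_not_forkP _ (nf_ext h12)).
rewrite (restrict_gtp AP) //; last exact: nf_ext h12.
exact/(does_not_forkP _ (nf_ext h01)).
Qed.

Lemma nf_unique M0 a M1 N b N' : nf s M0 a M1 N -> nf s M0 b M1 N' ->
  tp a M0 N = tp b M0 N' -> tp a M1 N = tp b M1 N'.
Proof.
move=> h h' e; have [[s0 s1 _] M01 _ _] := nf_domain G h.
apply: (nf_uniqueness G s0 s1 M01).
- exact/(does_not_forkP _ (nf_ext h)).
- exact/(does_not_forkP _ (nf_ext h')).
- by rewrite !(restrict_gtp AP) //; [exact: nf_ext h'|exact: nf_ext h].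
Qed.

(** The extension axiom gives a point [b], independent from [M2] over [M1], with the type of [a]
    over [M1]. A copy of [N] is placed around [b], and transitivity leads down to [M0]. *)
Lemma nf_extend M0 a M1 M2 N : nf s M0 a M1 N -> sized M2 -> prec K M1 M2 ->
  exists P g, [/\ sized P, prec K M2 P, K_embedding K g N P, fixes g M1
    & nf s M0 (g a) M2 P].
Proof.
move=> h s2 M12; have [[s0 s1 sN] M01 M1N _] := nf_domain G h.
have [_ ba] := nf_basic G h.
have [q [bq rq [_ [b [Q [hb qE]]]]]] := nf_extension G s1 s2 M12 ba.
move: rq; rewrite qE (restrict_gtp AP) //; last exact: nf_ext hb.
move=> /(gtp_eq_amalgam AP (nf_ext h))[P [g [sP QP gP gM1 gb]]].
have [[_ _ sQ] _ M2Q _] := nf_domain G hb.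
exists P, g; split=> //; first exact: prec_trans QP.
apply: nf_trans (_ : nf s M0 (g a) M1 P) _.
  have := nf_image h sP gP; rewrite !(@image_sized_fixes _ K lambda) //.
  exact: fixes_sub M01 gM1.
by rewrite gb; exact: nf_up hb sP QP.
Qed.

(** The extension axiom from [M] to [M] itself returns the given type. *)
Lemma nf_refl M a N : ext M (a, N) -> basic s M (tp a M N) -> nf s M a M N.
Proof.
move=> aN ba; have [sM sN MN Na] := aN.
have [q [bq rq [_ [b [Q [hb qE]]]]]] := nf_extension G sM sM (prec_refl sM.1) ba.
move: rq; rewrite qE (restrict_gtp AP) //; last 2 first.
- exact: prec_refl sM.1.
- exact: nf_ext hb.
exact: nf_gtp hb aN.
Qed.

Lemma nf_basic0 M0 a M1 M3 : nf s M0 a M1 M3 -> basic s M0 (tp a M0 M3).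
Proof. by move/(nf_basic G) => []. Qed.

Lemma nf_basic1 M0 a M1 M3 : nf s M0 a M1 M3 -> basic s M1 (tp a M1 M3).
Proof. by move/(nf_basic G) => []. Qed.

(* Symmetry only provides some model containing [b] from which [a] is
   independent; enlarging it by the extension property, [N] can be copied
   inside. *)
Lemma symmetric_amalgam M a A b N :
  ext M (a, A) -> ext M (b, N) -> basic s M (tp a M A) -> basic s M (tp b M N) ->
  exists P f g, [/\ sized P, K_embedding K f A P /\ K_embedding K g N P,
    fixes f M /\ fixes g M, nf s M (f a) (image_structure g N) P
    & nf s M (g b) (image_structure f A) P].
Proof.
move=> aA bN ba bb; have [/= sM sA MA Aa] := aA; have [_ /= sN MN Nb] := bN.
have [M3 [k [s3 AM3 kM3 kM hk]]] := nf_extend (nf_refl bN bb) sA MA.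
have ba3 : basic s M (tp a M M3) by rewrite (gtp_prec AP aA).
have [M2 [M3' [[s2 s3'] [MM2 M23'] M33' M2kb ha]]] :=
  nf_symmetry G sM sA s3 MA AM3 Aa ba3 hk.
have kM3' := K_embedding_extend kM3 M33'.
have kbM2 : ext M (k b, M2) by split.
(* Since [k b] in [M2] has the type of [b], some [M2'] above [M2] contains a copy of [N] around
   [k b]. Moving [a] to be independent from [M2'] fixes [M2], hence [k b]. *)
have : tp (k b) M M2 = tp b M N.
  by rewrite -(gtp_prec AP kbM2 s3') // (gtp_embedding AP bN).
move=> /(gtp_eq_amalgam AP bN)[M2' [g [s2' M22' gM2' gM gb]]].
have [P [h [sP M2'P hP hM2 hha]]] := nf_extend ha s2' M22'.
have gP := K_embedding_extend gM2' M2'P.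
exists P, h, g; split=> //.
- split=> //; apply: K_embedding_restrict hP; exact: prec_trans M33'.
- by split=> //; exact: fixes_sub MM2 hM2.
- apply: nf_between hha _ _ _ _ _ => //; last 2 first.
  + exact: (K_embedding_prec sM MN gM (K_embedding_iso (prec_models_l gM2'.2)
    (isomorphism_image gM2'.1))).
  + by case: gM2'.
  + by apply: sized_image => //; case: gM2'.
  + exact: prec_refl sM.1.
have := nf_image (nf_up hk s3' M33') sP hP.
by rewrite (image_sized_fixes sM) ?gb ?(hM2 (k b)) //; exact: fixes_sub MM2 hM2.
Qed.

(** Domination: [P] and the symmetric amalgam of [A] and [N] both make [b] independent from [A], so
    the uniqueness triple maps them compatibly into one model [Q]. Independence of [a] from [N] is
    carried from the symmetric amalgam to [Q] and pulled back to [P]. *)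
Lemma uniqueness_triple_nf M b N A a P g : uniqueness_triple K lambda s b M N ->
  prec K M A -> sized A -> prec K A P -> sized P -> K_embedding K g N P -> fixes g M ->
  nf s M (g b) A P -> carrier A a -> basic s M (tp a M P) ->
  nf s M a (image_structure g N) P.
Proof.
move=> [bN bb uniq] MA sA AP' sP gP gM hb Aa ba; have [sM sN MN Nb] := bN.
have aA : ext M (a, A) by split.
have ba' : basic s M (tp a M A) by rewrite -(gtp_prec AP aA sP).
have [P' [f' [g' [sP' [f'P' g'P'] [f'M g'M] ha' hb']]]] :=
  symmetric_amalgam aA bN ba' bb.
have am : nonforking_amalgam K lambda s b M N A id g P.
  split=> //; first by split=> //; exact: K_embedding_id.
  by rewrite image_structure_id; apply/(does_not_forkP _ (nf_ext hb)).
have am' : nonforking_amalgam K lambda s b M N A f' g' P'.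
  by split=> //; apply/(does_not_forkP _ (nf_ext hb')).
have [Q [h [h' [sQ hQ h'Q hf hg]]]] := uniq _ _ _ _ _ _ _ sA MA am am'.
apply: (nf_image_inv sM _ _ hQ).
- by apply: (K_embedding_prec sM MN gM); apply: K_embedding_iso; [apply:
  (K_embedding_models gP).1|apply: isomorphism_image; case: gP].
- split=> //=; [by apply: sized_image => //; case: gP|by case: gP|exact:
  (prec_carrier AP')].
have h'M x : carrier M x -> h x = h' x.
  by move=> Mx; have := hf x (prec_carrier MA Mx); rewrite /= f'M.
rewrite (hf _ Aa) (image_structure_eq (sized_structure sM) h'M).
rewrite image_structure_comp (_ : image_structure (h \o g) N = image_structure (h' \o
  g') N).
  by rewrite -image_structure_comp; exact: nf_image ha' sQ h'Q.
exact: image_structure_eq (sized_structure sN) hg.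
Qed.

End nonforking.

(** * Comparison of two frames *)

Section exhaustion.
Context (X : Type) (good : X -> Prop) (leX : X -> X -> Prop) (lambda : SmallType).
Hypothesis leX_refl : forall x, good x -> leX x x.
Hypothesis leX_trans : forall x y z, leX x y -> leX y z -> leX x z.
Hypothesis chain_bound : forall (I : SmallType) (le : rel I) (F : I -> X),
  well_order le -> [set: I] #<= [set: lambda] -> [set: I] !=set0 ->
  (forall i, good (F i)) -> (forall i j, strict le i j -> leX (F i) (F j)) ->
  exists2 u, good u & forall i, leX (F i) u.

(** Along a well-order of [lambda], step [i] passes to an extension satisfying [A i] if there is
    one; otherwise [A i] fails everywhere above. Both outcomes persist upwards, so a bound of the
    whole chain decides every [A i]. *)
Lemma exhaustion (A : lambda -> X -> Prop) (x0 : X) :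
  (forall i x y, good x -> good y -> leX x y -> A i x -> A i y) -> good x0 ->
  exists y, [/\ good y, leX x0 y
    & forall i, A i y \/ forall z, good z -> leX y z -> ~ A i z].
Proof.
move=> Aup g0.
have [le wo] := exists_well_order lambda.
have /choice[step stepP] (ix : lambda * X) : exists y, good ix.2 ->
    [/\ good y, leX ix.2 y & A ix.1 y \/ forall z, good z -> leX y z -> ~ A ix.1 z].
  case: ix => i x /=; have [gx|] := pselect (good x); last by exists x.
  have [[y [gy xy Ay]]|h] := pselect (exists y, [/\ good y, leX x y & A i y]).
    by exists y => _; split=> //; left.
  exists x => _; split=> //; [exact: leX_refl|right=> z gz xz Az].
  by apply: h; exists z.
pose below i F u := [/\ good u, leX x0 u & forall j, strict le j i -> leX (F j) u].
have /choice[bnd bndP] (iF : lambda * (lambda -> X)) :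
    exists u, (exists u, below iF.1 iF.2 u) -> below iF.1 iF.2 u.
  have [[u hu]|h] := pselect (exists u, below iF.1 iF.2 u); first by exists u.
  by exists x0 => /h.
(* Only earlier values are available to the recursion; [x0] fills in the others, so that the bound
   can be chosen for a total function. *)
pose body i (rec : forall j, strict le j i -> X) :=
  step (i, bnd (i, fun j => if pselect (strict le j i) is left h then rec j h else x0)).
pose F := Fix (strict_wf wo) (fun=> X) body.
have FE i : F i = step (i, bnd (i, fun j => if pselect (strict le j i) then F j else
  x0)).
  rewrite /F Fix_eq => [|j r r' rr']; rewrite /body; congr (step (_, bnd (_, _)));
    by apply/funext => k; case: pselect => /=.
have FP i : [/\ good (F i), leX x0 (F i), forall j, strict le j i -> leX (F j) (F i)
    & A i (F i) \/ forall z, good z -> leX (F i) z -> ~ A i z].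
  elim/(well_founded_ind (strict_wf wo)): i => i IH.
  (* At the least index there is nothing to bound, and [x0] itself serves; later, an earlier value
     already lies above [x0]. *)
  have [u ubound] : exists u, below i F u.
    have [J0|J0] := pselect ([set j | strict le j i] !=set0); last first.
      exists x0; split=> //; first exact: leX_refl.
      by move=> j ji; case: J0; exists j.
    have [||||u gu hu] := chain_bound (suborder_wo wo (D := [set j | strict le j i]))
        (F := fun j => F (sval j)).
    - by apply/card_leT_injP; exists sval => -[x hx] [y hy] /= e; exact: eq_exist.
    - by case: J0 => j ji; exists (exist _ j ji).
    - by move=> [j /= ji]; have [] := IH j ji.
    - by move=> [j ji] [k /= ki] /suborder_strict jk; have [_ _ + _] := IH k ki; apply.
    have {}hu j : strict le j i -> leX (F j) u by move=> ji; exact: (hu (exist _ j ji)).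
    exists u; split=> //; case: J0 => j ji; apply: leX_trans (hu j ji).
    by have [] := IH j ji.
  have : below i F (bnd (i, fun j => if pselect (strict le j i) then F j else x0)).
    have [|gb xb Fb] := bndP (i, fun j => if pselect (strict le j i) then F j else x0).
      exists u; case: ubound => gu xu Fu; split=> //= j ji.
      by case: pselect => //= _; exact: Fu.
    split=> // j ji; have /= := Fb j ji; by case: pselect.
  rewrite FE; set v := bnd _ => -[gv xv Fv].
  have [/= gs vs As] := stepP (i, v) gv.
  split=> //; first exact: leX_trans vs.
  by move=> j ji; apply: leX_trans (Fv j ji) vs.
have [l0|nl] := pselect ([set: lambda] !=set0); last first.
  by exists x0; split=> //; [exact: leX_refl|move=> i; case: nl; exists i].
have [||u gu hu] := chain_bound wo (card_lexx _) l0 (F := F).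
- by move=> i; have [] := FP i.
- by move=> i j; have [_ _ + _] := FP j; apply.
exists u; split=> //.
  by case: l0 => i _; have [_ + _ _] := FP i => /leX_trans; apply; exact: hu.
move=> i; have Fu := hu i; have [gF _ _ [AF|nA]] := FP i.
  by left; exact: Aup Fu AF.
by right=> z gz uz; apply: nA => //; exact: leX_trans uz.
Qed.

End exhaustion.

(** * Agreement of nonforking in two frames *)

Section comparison.
Context (L : language) (K : AEC L) (lambda : SmallType) (s1 s2 : frame L).
Hypothesis inf : infinite_set [set: lambda].
Hypothesis G1 : good_frame K lambda s1.
Hypothesis G2 : good_frame K lambda s2.
Hypothesis W2 : weakly_successful K lambda s2.
Hypothesis same_basic : forall M, models_of_size K lambda M -> basic s1 M = basic s2 M.
Implicit Types (M N P Q : structure L) (a b : V).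

Local Notation sized := (models_of_size K lambda).
Local Notation ext := (extension_with_point K lambda).
Local Notation tp := (gtp K lambda).
Let AP := good_amalgamation G1.

Lemma nat_le_lambda : [set: nat] #<= [set: lambda].
Proof. exact/infiniteP. Qed.

Lemma uniqueness_triple_nf12 M b N a P : uniqueness_triple K lambda s2 b M N ->
  nf s1 M a N P -> nf s2 M a N P.
Proof.
move=> UT ha; have [bN bb _] := UT; have [/= sM sN MN Nb] := bN.
have /choice[nx nxP] Q : exists Pg : structure L * (V -> V), sized Q -> prec K M Q ->
    [/\ sized Pg.1, prec K Q Pg.1, K_embedding K Pg.2 N Pg.1, fixes Pg.2 M
      & nf s2 M (Pg.2 b) Q Pg.1].
  have [[sQ MQ]|h] := pselect (sized Q /\ prec K M Q).
    by have [P' [g h]] := nf_extend G2 (nf_refl G2 bN bb) sQ MQ; exists (P', g).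
  by exists (Q, id) => sQ MQ; case: h.
(* [Q n.+1] contains the [n]-th copy of [N] over [M], given by [g n], whose point is s2-independent
   from [Q n]. *)
pose Q n := iter n (fun Q => (nx Q).1) M; pose g n := (nx (Q n)).2.
have QP n : sized (Q n) /\ prec K M (Q n).
  elim: n => [|n [sQ MQ]]; first by split=> //; exact: prec_refl sM.1.
  have [sP QP _ _ _] := nxP _ sQ MQ; split=> //=; exact: prec_trans QP.
have QS n : [/\ prec K (Q n) (Q n.+1), K_embedding K (g n) N (Q n.+1), fixes (g n) M
    & nf s2 M (g n b) (Q n) (Q n.+1)].
  by have [sQ MQ] := QP n; have [_ ? ? ? ?] := nxP _ sQ MQ.
have Qinc : increasing (prec K) leq Q.
  move=> i j /strict_leqP; elim: j => // j IH;
    rewrite ltnS leq_eqVlt => /orP[/eqP ->|/IH ij].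
    by have [] := QS j.
  by apply: prec_trans ij _; have [] := QS j.
set U := union_structure setT Q.
have n0 : [set: nat] !=set0 by exists 0%N.
have KQ n : setT n -> K (Q n) by move=> _; have [[]] := QP n.
have incQ i j : setT i -> setT j -> strict leq i j -> prec K (Q i) (Q j) by move=> _
  _; exact: Qinc.
have [_ QU] := chain_union_models nat_wo n0 KQ incQ.
have sU : sized U.
  apply: (chain_union_sized nat_wo n0 KQ incQ inf nat_le_lambda) => n _.
  by have [] := QP n.
have MU : prec K M U by exact: (QU 0%N).
have [P' [k [sP' UP' kP' kM hka]]] := nf_extend G1 (nf_refl G1 (nf_ext0 G1 ha)
  (nf_basic0 G1 ha)) sU MU.
have ba' : basic s2 U (tp (k a) U P') by rewrite -same_basic //; exact: nf_basic1 hka.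
have [n /(does_not_forkP G2 _ (nf_ext G1 hka)) h2n] :
  exists n, does_not_fork K lambda s2 (Q n) U (tp (k a) U P').
  apply: (nf_local_character G2 (le := leq)) => //.
  - split; [exact: nat_limit_ordinal|exact: nat_le_lambda].
  - by move=> n; have [] := QP n.
  - by move=> n /nat_no_limit_element.
have [sQn MQn] := QP n; have [sQSn _] := QP n.+1; have [QQ gQ gM hb] := QS n.
(* [U] is cut down to [Q n.+1], the first model known to contain the point [g n b], in order to
   apply symmetry over [Q n]. *)
have {}h2n : nf s2 (Q n) (k a) (Q n.+1) P'.
  by apply: (nf_between G2 h2n) => //; [exact: prec_refl sQn.1|exact: QU].
have QSP' : prec K (Q n.+1) P' by apply: prec_trans UP'; exact: QU.
have gbQ : carrier (Q n.+1) (g n b) by exact: K_embedding_carrier gQ Nb.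
have bgb : basic s2 (Q n) (tp (g n b) (Q n) P').
  rewrite (gtp_prec AP _ sP' QSP'); first exact: nf_basic1 G2 _ _ _ _ hb.
  exact: nf_ext G2 _ _ _ _ hb.
have [M2 [P2 [[sM2 sP2] [QM2 M2P2] P'P2 M2a hb2]]] :=
  nf_symmetry G2 sQn sQSn sP' QQ QSP' gbQ bgb h2n.
have MM2 : prec K M M2 by exact: prec_trans QM2.
have {}hb2 : nf s2 M (g n b) M2 P2.
  apply: (nf_trans G2) hb2; apply: (nf_up G2 hb sP2); exact: prec_trans P'P2.
have gP2 : K_embedding K (g n) N P2.
  by apply: K_embedding_extend gQ _; exact: prec_trans P'P2.
have ba0 : basic s1 M (tp (k a) M P2).
  by rewrite (gtp_prec AP (nf_ext0 G1 hka)) //; exact: nf_basic0 G1 _ _ _ _ hka.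
have h2 : nf s2 M (k a) (image_structure (g n) N) P2.
  by apply: (uniqueness_triple_nf G2 UT MM2 sM2 M2P2 sP2 gP2 gM hb2 M2a);
    rewrite -same_basic.
have h1 : nf s1 M (k a) (image_structure (g n) N) P2.
  apply: (nf_between G1 (nf_up G1 hka sP2 P'P2)) => //.
  - by apply: sized_image sN _; case: gP2.
  - exact: prec_refl sM.1.
  - apply: (K_embedding_prec sM MN gM); apply: K_embedding_iso; last by apply:
    isomorphism_image; case: gP2.
    by have [] := K_embedding_models gP2.
  - by apply: prec_trans (QU n.+1 I); case: gQ.
(* Renaming [P2] turns the [n]-th copy of [N] back into [N], so that [h (k a)] can be compared with
   [a] over [N]. *)
have [h [R [hR NR hg]]] := K_embedding_extension sN.1 gP2.
have sR := sized_isomorphism sP2 hR.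
have hemb := K_embedding_iso sR.1 hR.
have imN : image_structure h (image_structure (g n) N) = N.
  by rewrite image_structure_comp (image_sized_fixes sN).
have hM : fixes h M by move=> x Mx; rewrite -{1}(gM x Mx) hg //; exact:
  (prec_carrier MN).
have {}h1 : nf s1 M (h (k a)) N R.
  by have := nf_image G1 h1 sR hemb; rewrite imN (image_sized_fixes sM).
have {}h2 : nf s2 M (h (k a)) N R.
  by have := nf_image G2 h2 sR hemb; rewrite imN (image_sized_fixes sM).
apply: (nf_gtp G2 h2 (nf_ext G1 ha)).
apply: (nf_unique G1 h1 ha).
have kaP2 := nf_up G1 hka sP2 P'P2.
rewrite (gtp_embedding AP (nf_ext0 G1 kaP2) sR hemb hM).
rewrite (gtp_prec AP (nf_ext0 G1 hka) sP2 P'P2).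
exact (gtp_embedding AP (nf_ext0 G1 ha) sP' kP' kM).
Qed.

(** The agreeing pairs, phrased with points instead of types. *)
Definition nf_agree M N := [/\ sized M, sized N, prec K M N
  & forall a P, nf s1 M a N P -> nf s2 M a N P].

Lemma nf_agree_refl M : sized M -> nf_agree M M.
Proof.
move=> sM; split=> //; first exact: prec_refl sM.1.
move=> a P h; apply: (nf_refl G2); first exact: nf_ext G1 _ _ _ _ h.
by rewrite -same_basic //; exact: nf_basic0 G1 _ _ _ _ h.
Qed.

Lemma nf_agree_trans M N P : nf_agree M N -> nf_agree N P -> nf_agree M P.
Proof.
move=> [sM sN MN hMN] [_ sP NP hNP]; split=> //; first exact: prec_trans NP.
move=> a Q h; apply: (nf_trans G2 (M1 := N)).
  by apply: hMN; apply: (nf_between G1 h) => //; exact: prec_refl sM.1.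
by apply: hNP; apply: (nf_between G1 h) => //; exact: prec_refl sP.1.
Qed.

(** The point is first made s1-independent from the larger [N], without changing its type over [N'].
    Agreement applies there, and monotonicity of [s2] comes back to [N']. *)
Lemma nf_agree_sub M N N' : nf_agree M N -> sized N' -> prec K M N' -> prec K N' N ->
  nf_agree M N'.
Proof.
move=> [sM sN MN hMN] sN' MN' N'N; split=> // a P h.
have [Q [g [sQ NQ gQ gN' hg]]] := nf_extend G1 h sN N'N.
apply: (nf_image_inv G2 sM MN' (nf_ext G1 h) gQ).
rewrite !(@image_sized_fixes _ K lambda) //; last exact: fixes_sub MN' gN'.
by apply: (nf_between G2 (hMN _ _ hg)) => //; exact: prec_refl sM.1.
Qed.

(** A renaming [k] that undoes [g] reduces the copy to the triple itself. *)
Lemma nf_agree_uniqueness_triple M b N Q g : uniqueness_triple K lambda s2 b M N ->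
  K_embedding K g N Q -> fixes g M -> nf_agree M (image_structure g N).
Proof.
move=> UT gQ gM; have [[/= sM sN MN Nb] _ _] := UT.
have [gI _] := gQ; have sgN := sized_image sN gI.
have giso := K_embedding_iso sgN.1 (isomorphism_image gI).
split=> //; first exact: K_embedding_prec sM MN gM giso.
move=> a P h; have [[_ _ sP] _ gNP _] := nf_domain G1 h.
have gP := K_embedding_extend giso gNP.
have [k [R [kR NR kg]]] := K_embedding_extension sN.1 gP.
have sR := sized_isomorphism sP kR.
have kemb := K_embedding_iso sR.1 kR.
have imN : image_structure k (image_structure g N) = N.
  by rewrite image_structure_comp (image_sized_fixes sN).
have kM : fixes k M by move=> x Mx; rewrite -{1}(gM x Mx) kg //; exact:
  (prec_carrier MN).
apply: (nf_image_inv G2 sM _ (nf_ext G1 h) kemb).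
  exact: K_embedding_prec sM MN gM giso.
rewrite imN (image_sized_fixes sM) //.
apply: (uniqueness_triple_nf12 UT).
by have := nf_image G1 h sR kemb; rewrite imN (image_sized_fixes sM).
Qed.

Section unions.
Context (I : SmallType) (le : rel I) (M : I -> structure L).
Hypothesis wo : well_order le.
Hypothesis leI : [set: I] #<= [set: lambda].
Hypothesis sM : forall i, sized (M i).
Hypothesis incM : forall i j, strict le i j -> nf_agree (M i) (M j).

Let KM i : K (M i). Proof. by have [] := sM i. Qed.
Let precM i j : strict le i j -> prec K (M i) (M j).
Proof. by move/incM => []. Qed.

Lemma nf_agree_chain i j : le i j -> nf_agree (M i) (M j).
Proof.
move=> ij; have [<-|ne] := pselect (i = j); first exact/nf_agree_refl/sM.
exact: incM.
Qed.

(* The chain need not be continuous, so continuity of [s2] is applied to the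
   continuous chain of the unions of its proper initial segments, started at
   [M i0]. *)
Lemma nf_agree_union i0 : nf_agree (M i0) (union_structure setT M).
Proof.
set U := union_structure setT M.
have I0 : [set: I] !=set0 by exists i0.
have KMD (D : set I) i : D i -> K (M i) by move=> _.
have precMD (D : set I) i j : D i -> D j -> strict le i j -> prec K (M i) (M j).
  by move=> _ _; exact: precM.
have [_ MU] := chain_union_models wo I0 (KMD _) (precMD _).
have sU : sized U.
  exact: (chain_union_sized wo I0 (KMD _) (precMD _) inf leI (fun i _ => sM i)).
have leM i j : le i j -> prec K (M i) (M j) by move/nf_agree_chain => [].
have [[m mmax]|nomax] := pselect (exists m, forall i, le i m).
  have -> : U = M m.
    by apply: union_structure_max => // i _; exact/prec_sub_interp/leM.
  exact: nf_agree_chain.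
have nolast i : exists j, strict le i j.
  apply: contrapT => nj; apply: nomax; exists i => k.
  by apply: contrapT => /(strictP wo) ik; apply: nj; exists k.
pose seg i := [set j | strict le j i].
pose M' i := if `[< le i i0 >] then M i0 else union_structure (seg i) M.
have M'le i : le i i0 -> M' i = M i0 by move=> h; rewrite /M' asboolT.
have M'gt i : ~ le i i0 -> M' i = union_structure (seg i) M by move=> h;
  rewrite /M' asboolF.
have seg0 i : ~ le i i0 -> seg i !=set0 by move=> /(strictP wo) h; exists i0.
have segP i : ~ le i i0 -> [/\ sized (union_structure (seg i) M),
    forall j, strict le j i -> prec K (M j) (union_structure (seg i) M)
    & forall N, (forall j, strict le j i -> prec K (M j) N) ->
      prec K (union_structure (seg i) M) N].
  move=> ni; have [_ ps] := chain_union_models wo (seg0 i ni) (KMD _) (precMD _);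
    split=> //.
    exact: (chain_union_sized wo (seg0 i ni) (KMD _) (precMD _) inf leI (fun i _ =>
      sM i)).
  by move=> N; exact: (chain_union_prec wo (seg0 i ni) (KMD _) (precMD _)).
have agree i : nf_agree (M i0) (M' i).
  have [h|h] := pselect (le i i0); first by rewrite M'le //; exact: nf_agree_refl.
  have [ss ps us] := segP i h; rewrite M'gt //.
  have hi : strict le i0 i by apply/(strictP wo).
  (* The union of the segment lies between [M i0] and [M i], so it inherits agreement from the pair
     formed by these two. *)
  apply: nf_agree_sub (incM hi) ss (ps _ hi) _; apply: us => j; exact: precM.
have sM' i : sized (M' i) by have [] := agree i.
have M'M i : le i0 i -> prec K (M' i) (M i).
  move=> h0; have [h|h] := pselect (le i i0); first by rewrite M'le //; exact: leM.
  by have [ss ps us] := segP i h; rewrite M'gt //; apply: us => j; exact: precM.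
have nle i j : strict le i j -> le i0 i -> ~ le j i0.
  move=> ij h0 ji; move/(strictP wo): ij; apply; exact: (wo_trans wo) ji h0.
have MM' i j : le i0 i -> strict le i j -> prec K (M i) (M' j).
  move=> h0 ij; have nj := nle i j ij h0.
  by have [_ ps _] := segP j nj; rewrite M'gt //; exact: ps.
have M'inc : increasing (prec K) le M'.
  move=> i j ij; have [hi|hi] := pselect (le i i0); last first.
    have h0 : le i0 i by case: (wo_total wo i i0).
    exact: prec_trans (M'M i h0) (MM' i j h0 ij).
  rewrite (M'le i) //; by have [] := agree j.
have M'U : union_structure setT M' = U.
  apply: union_structure_cofinal => i _.
    have [h|h] := pselect (le i i0).
      by exists i0 => //; rewrite M'le //; exact: sub_interp_refl.
    exists i => //; apply/prec_sub_interp/M'M; by case: (wo_total wo i i0).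
  (* [j] lies strictly above the larger of [i] and [i0], so [M' j] contains [M i]. *)
  have [j ij] := nolast (if `[< le i i0 >] then i0 else i).
  exists j => //; move: ij; case: asboolP => h ij.
    apply: sub_interp_trans (prec_sub_interp (leM _ _ h)) _.
    by apply/prec_sub_interp/MM' => //; exact: (wo_refl wo).
  by apply/prec_sub_interp/MM' => //; case: (wo_total wo i i0).
have M'cont : continuous_chain le M'.
  move=> i [[i1 ii1] lim].
  have [h|h] := pselect (le i i0).
    have M'lt j : strict le j i -> M' j = M i0.
      by move=> [ij _]; apply: M'le; exact: wo_trans ij h.
    rewrite M'le // (@union_structure_max _ _ _ _ i1) ?M'lt // => j ji.
    by rewrite !M'lt //; exact: sub_interp_refl.
  rewrite M'gt //; have hi : strict le i0 i by apply/(strictP wo).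
  apply: union_structure_cofinal => j /= ji.
    (* [j'] is the larger of [j] and [i0]; as [i] is a limit, there is a [k] strictly between [j']
       and [i], and [M' k] contains [M j']. *)
    have [j' [ji' j0 jj']] : exists j', [/\ strict le j' i, le i0 j' & le j j'].
      case: (wo_total wo j i0) => h0; first by exists i0; split=> //; exact:
        (wo_refl wo).
      by exists j; split=> //; exact: (wo_refl wo).
    have [k j'k ki] := lim j' ji'; exists k => //.
    apply: sub_interp_trans (prec_sub_interp (leM _ _ jj')) _.
    exact/prec_sub_interp/MM'.
  have [h0|h0] := pselect (le j i0).
    by exists i0 => //; rewrite M'le //; exact: sub_interp_refl.
  exists j => //; apply/prec_sub_interp/M'M; by case: (wo_total wo j i0).
have M0U : prec K (M i0) U by exact: MU.
split=> // a P h; have [[_ _ sP] _ UP _] := nf_domain G1 h.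
(* Continuity takes its base at the least index, where [M'] still has the value [M i0]. *)
have [imin _ iminP] := wo_min wo I0.
have M'min : M' imin = M i0 by rewrite M'le //; exact: iminP.
have lim : limit_below_succ lambda le.
  split=> //; exact: wo_limit_ordinal.
have M'U' i : prec K (M' i) U.
  have [h0|h0] := pselect (le i i0); first by rewrite M'le //; exact: MU.
  have ii0 : le i0 i by case: (wo_total wo i i0).
  exact: prec_trans (M'M i ii0) (MU i Logic.I).
have := nf_continuity G2 (M := M') (i0 := imin) (p := tp a U P) lim sM' M'inc M'cont.
rewrite M'U M'min => /(_ (fun i => iminP i Logic.I)) [].
- by exists a, P; split=> //; exact: nf_ext G1 _ _ _ _ h.
- move=> i; rewrite (restrict_gtp AP) //; last exact: nf_ext G1 _ _ _ _ h.
  have [_ _ pi ai] := agree i.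
  have h2 : nf s2 (M i0) a (M' i) P.
    by apply/ai/(nf_between G1 h) => //; exact: prec_refl (KM i0).
  split; first exact: nf_basic1 G2 _ _ _ _ h2.
  exact/(does_not_forkP G2 _ (nf_ext G2 h2)).
- by move=> _ /(does_not_forkP G2 _ (nf_ext G1 h)).
Qed.

End unions.

Let good_pair (p : structure L * structure L) :=
  [/\ sized p.1, sized p.2 & prec K p.1 p.2].
(** The first model grows along agreeing pairs and is meant to catch up with the second, which only
    has to grow in the order of the class. *)
Let le_pair (p q : structure L * structure L) :=
  nf_agree p.1 q.1 /\ prec K p.2 q.2.

Lemma le_pair_refl p : good_pair p -> le_pair p p.
Proof. by move=> [s1p s2p _]; split; [exact: nf_agree_refl|exact: prec_refl s2p.1]. Qed.

Lemma le_pair_trans p q r : le_pair p q -> le_pair q r -> le_pair p r.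
Proof.
by move=> [pq1 pq2] [qr1 qr2]; split; [exact: nf_agree_trans qr1|exact: prec_trans qr2].
Qed.

Lemma le_pair_union (I : SmallType) (le : rel I) (F : I -> structure L * structure L) :
  well_order le -> [set: I] #<= [set: lambda] -> [set: I] !=set0 ->
  (forall i, good_pair (F i)) -> (forall i j, strict le i j -> le_pair (F i) (F j)) ->
  let u := (union_structure setT (fun i => (F i).1), union_structure setT (fun i =>
    (F i).2)) in
  good_pair u /\ forall i, le_pair (F i) u.
Proof.
move=> wo leI I0 gF incF /=.
have agree i : nf_agree (F i).1 (union_structure setT (fun i => (F i).1)).
  apply: (nf_agree_union (M := fun i => (F i).1) wo leI).
    by move=> j; have [] := gF j.
  by move=> j k /incF[].
have K1 i : setT i -> K (F i).1 by move=> _; have [[]] := gF i.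
have K2 i : setT i -> K (F i).2 by move=> _; have [_ []] := gF i.
have i1 i j : setT i -> setT j -> strict le i j -> prec K (F i).1 (F j).1.
  by move=> _ _ /incF[[]].
have i2 i j : setT i -> setT j -> strict le i j -> prec K (F i).2 (F j).2.
  by move=> _ _ /incF[].
have [_ U2] := chain_union_models wo I0 K2 i2.
split; last by move=> i; split=> //=; exact: U2.
split=> /=; first by case: I0 => i _; have [] := agree i.
  by apply: (chain_union_sized wo I0 K2 i2 inf leI) => i _; have [] := gF i.
apply: (chain_union_prec wo I0 K1 i1) => i _.
by have [_ _ h] := gF i; apply: prec_trans h _; exact: U2.
Qed.

(** Density gives a point [a] of [N] outside [M] with basic type, which a uniqueness triple of [s2]
    over [M] realizes as well. Equality of types yields [Q] above [N] with a copy of the triple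
    whose point is [a]; this copy is the new first model. *)
Lemma le_pair_step p : good_pair p -> p.1 <> p.2 ->
  exists q x, [/\ good_pair q, le_pair p q, carrier p.2 x, ~ carrier p.1 x & carrier
    q.1 x].
Proof.
case: p => M N [/= sM sN MN] ne.
have [a [Na nMa ba]] := basic_density G2 sM sN MN ne.
have [N' [b [e UT]]] := W2 sM ba; have [bN' _ _] := UT.
have [Q [g [sQ NQ gQ gM gb]]] := gtp_eq_amalgam AP bN' e.
have agr := nf_agree_uniqueness_triple UT gQ gM.
exists (image_structure g N', Q), a; split=> //=.
- by case: agr => _ sg _ _; split=> //; case: gQ.
- by case: bN' => _ _ _ Nb; exists b.
Qed.

(** Exhaustion along the enumeration [d] of the second model, the [i]-th property being that [d i]
    belongs to the first model. *)
Lemma le_pair_saturate p : good_pair p -> exists q, [/\ good_pair q, le_pair p q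
  & forall x, carrier p.2 x -> carrier q.1 x \/
    forall r, good_pair r -> le_pair q r -> ~ carrier r.1 x].
Proof.
move=> gp; have [_ [_ /card_eqPle[/(card_le_injP _ _ _) cN _]] _] := gp.
have [l0 _] := infinite_setN0 inf.
have [c cI _] := cN l0.
have [d dc] := set_inj_inv (existT (fun A : SmallType => A) unit tt : V) cI.
have [||q [gq pq hq]] := @exhaustion _ good_pair le_pair lambda le_pair_refl
  le_pair_trans _
    (fun i r => carrier r.1 (d i)) p _ gp.
- move=> I le F wo leI I0 gF incF.
  by have [gu hu] := le_pair_union wo leI I0 gF incF; eexists; [exact: gu|].
- by move=> i q r _ _ [[_ _ /prec_carrier qr _] _]; exact: qr.
by exists q; split=> // x px; rewrite -(dc x px); exact: hq.
Qed.

(** Saturation may enlarge the second model, so it is iterated along [nat]. If the two unions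
    differed, a further step would put some new [x] of the second union into the first model; but
    [x] appears at a finite stage [n], and stage [n.+1] has excluded this for every [x] that it does
    not already contain. *)
Lemma all_nf_agree M N : sized M -> sized N -> prec K M N -> nf_agree M N.
Proof.
move=> sM sN MN.
have /choice[nx nxP] p : exists q, good_pair p -> [/\ good_pair q, le_pair p q
  & forall x, carrier p.2 x -> carrier q.1 x \/
    forall r, good_pair r -> le_pair q r -> ~ carrier r.1 x].
  by have [/le_pair_saturate[q h]|] := pselect (good_pair p); [exists q|exists p].
pose F n := iter n nx (M, N).
have gF n : good_pair (F n).
  by elim: n => [|n /nxP[]].
have FS n := nxP _ (gF n).
have incF i j : strict leq i j -> le_pair (F i) (F j).
  move=> /strict_leqP; elim: j => // j IH; rewrite ltnS leq_eqVlt => /orP[/eqP ->|/IH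
    ij].
    by have [] := FS j.
  by apply: le_pair_trans ij _; have [] := FS j.
have [|gu hu] := le_pair_union nat_wo nat_le_lambda _ gF incF; first by exists 0%N.
move: gu hu; set u := (_, _) => gu hu.
have e : u.1 = u.2.
  apply: contrapT => /(le_pair_step gu)[q [x [gq uq [n _ Nx] nux qx]]].
  have [_ _ /(_ x Nx)[Mx|nx']] := FS n.
    by apply: nux; exists n.+1.
  by apply: (nx' q) => //; apply: le_pair_trans uq; exact: (hu n.+1).
have [agr Nu] := hu 0%N.
by apply: nf_agree_sub agr sN MN _; rewrite e.
Qed.

Lemma nf12 M a N P : nf s1 M a N P -> nf s2 M a N P.
Proof.
move=> h; have [[sM sN _] MN _ _] := nf_domain G1 h.
by have [_ _ _] := all_nf_agree sM sN MN; apply.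
Qed.

Lemma nf21 M a N P : nf s2 M a N P -> nf s1 M a N P.
Proof.
move=> h; have [[sM sN _] MN _ _] := nf_domain G2 h.
have ba : basic s1 M (tp a M P) by rewrite same_basic //; exact: nf_basic0 G2 _ _ _ _ h.
have aP := nf_ext0 G2 h.
have [Q [g [sQ NQ gQ gM hg]]] := nf_extend G1 (nf_refl G1 aP ba) sN MN.
apply: (nf_gtp G1 hg (nf_ext G2 h)); apply: (nf_unique G2 (nf12 hg) h).
exact (gtp_embedding AP aP sQ gQ gM).
Qed.

End comparison.

Theorem theorem6p13 (L : language) (K : AEC L) (lambda : SmallType)
    (s1 s2 : frame L) :
  LS_le K lambda ->
  good_frame K lambda s1 -> weakly_successful K lambda s1 ->
  good_frame K lambda s2 -> weakly_successful K lambda s2 ->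
  (forall M, models_of_size K lambda M -> basic s1 M = basic s2 M) ->
  forall M0 a M1 M3, nf s1 M0 a M1 M3 <-> nf s2 M0 a M1 M3.
Proof.
move=> [kappa [[kinf _ _] _] kl] G1 _ G2 W2 same_basic M0 a M1 M3.
(* [LS_property] makes [kappa] infinite, and [kappa] injects into [lambda]. *)
have inf : infinite_set [set: lambda].
  by move/infiniteP: kinf => kinf; apply/infiniteP; exact: card_le_trans kl.
split; first exact: (nf12 inf G1 G2 W2 same_basic).
exact: (nf21 inf G1 G2 W2 same_basic).
Qed.
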